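(* Let $P$ be a nonempty set of odd primes, and let $\mathcal{M}\subset\mathcal{G}$ be a nonzero $A_P$-submodule spanned by simple $D_{2n}$-modules with $n$ odd, such that for each fixed $n$ either all simple $D_{2n}$-modules or none belong to $\mathcal{M}$. Let $p\in P$ and put $$T^1_{P,\mathcal{M}}=A_{P,\mathcal{M}}/\langle \mathrm{Res}_p\mathrm{Ind}_p-p\rangle,\qquad T^2_{P,\mathcal{M}}=A_{P,\mathcal{M}}/\langle \mathrm{Res}_p\mathrm{Ind}_p-1\rangle .$$ Then the algebras $T^1_{P,\mathcal{M}}$ and $T^2_{P,\mathcal{M}}$ are indecomposable (i.e. neither is a direct sum of two nonzero algebras).
   Context: All vector spaces are over $\mathbb{C}$; modules are left modules and finite-dimensional. For an integer $n\ge 3$ let $D_{2n}=\langle r_n,s_n\mid r_n^n=1,\ s_n^2=1,\ s_nr_ns_n=r_n^{-1}\rangle$ be the dihedral group of order $2n$ (dihedral groups are left undefined for $n=1,2$). For a prime $p$, $D_{2n}$ is embedded in $D_{2pn}$ by $r_n\mapsto r_{pn}^p$, $s_n\mapsto s_{pn}$. Let $\mathcal{G}$ be the complexified Grothendieck group of $\bigoplus_{n\ge 3}D_{2n}\text{-mod}$, i.e. the complex vector space with basis the isomorphism classes of simple $D_{2n}$-modules, $n\ge 3$; a module is identified with its class in $\mathcal{G}$. Linear endomorphisms $\mathrm{Ind}_p,\mathrm{Res}_p$ of $\mathcal{G}$ are defined as follows: $\mathrm{Ind}_p$ sends a $D_{2n}$-module to the $D_{2pn}$-module induced from it along the embedding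 above; $\mathrm{Res}_p$ sends a $D_{2n}$-module to its restriction to $D_{2n/p}$ if $p\mid n$ and $n/p\ge 3$, and to $0$ otherwise. For a set $P$ of primes, $A_P$ is the free unital associative $\mathbb{C}$-algebra on the symbols $\mathrm{Res}_p,\mathrm{Ind}_p$ ($p\in P$), acting on $\mathcal{G}$ by these operators. For an $A_P$-submodule $\mathcal{M}\subset\mathcal{G}$, $\mathrm{Ann}_{A_P}(\mathcal{M})$ is the ideal of elements annihilating every element of $\mathcal{M}$, and $A_{P,\mathcal{M}}=A_P/\mathrm{Ann}_{A_P}(\mathcal{M})$; the symbols $\mathrm{Res}_p,\mathrm{Ind}_p$ also denote their images in $A_{P,\mathcal{M}}$. $\langle x\rangle$ in a quotient denotes the two-sided ideal generated by $x$. *)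

(* Defs.v *)
From HB Require Import structures.
From mathcomp Require Import all_boot all_order all_algebra.
From mathcomp Require Import all_fingroup all_solvable all_character.
From mathcomp Require Import finmap generic_quotient ring_quotient.
From mathcomp Require Import boolp classical_sets reals.
From mathcomp.real_closed Require Import complex.
From mathcomp.multinomials Require Import monalg.

Set Implicit Arguments.
Unset Strict Implicit.
Unset Printing Implicit Defensive.

Import GRing.Theory.

Local Open Scope ring_scope.

(* Unital associative algebras, the zero algebra included.  The quotients below
   may a priori be zero, and the library's algType only covers 1 != 0. *)
Record algebra (C : comNzRingType) := Algebra {
  alg_ring :> pzRingType;
  alg_scale : C -> alg_ring -> alg_ring;
  alg_scaleA : forall a b x, alg_scale a (alg_scale b x) = alg_scale (a * b) x;
  alg_scale1 : forall x, alg_scale 1 x = x;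
  alg_scaleDr : forall a x y,
    alg_scale a (x + y) = alg_scale a x + alg_scale a y;
  alg_scaleDl : forall a b x,
    alg_scale (a + b) x = alg_scale a x + alg_scale b x;
  alg_scaleAl : forall a x y, alg_scale a (x * y) = alg_scale a x * y;
  alg_scaleAr : forall a x y, alg_scale a (x * y) = x * alg_scale a y
}.

Definition algebra_of_algType (C : comNzRingType) (A : algType C) : algebra C :=
  @Algebra C A *:%R (@scalerA C A) (@scale1r C A) (@scalerDr C A)
    (fun a b x => @scalerDl C A x a b) (@scalerAl C A) (@scalerAr C A).

(* An algType is nonzero, so B1 and B2 are automatically nonzero here. *)
Definition indecomposable (C : comNzRingType) (A : algebra C) : Prop :=
  ~ exists (B1 B2 : algType C) (f : {rmorphism A -> (B1 * B2)%type}),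
      (forall a x, f (alg_scale a x) = a *: f x) /\ bijective f.

Section Ideals.
Variables (C : comNzRingType) (A : algebra C).

Definition two_sided_ideal (I : set A) : Prop :=
  [/\ I 0,
      forall x y, I x -> I y -> I (x + y)
    & forall a x b, I x -> I (a * x * b)].

Record ideal := Ideal {
  ideal_set :> A -> Prop;
  idealP : two_sided_ideal ideal_set
}.

Definition ideal_gen_set (x : A) : set A :=
  [set y | forall I : ideal, I x -> I y]%classic.

Lemma ideal_gen_subproof x : two_sided_ideal (ideal_gen_set x).
Proof.
split=> [I _|y z Ly Lz I Ix|a y b Ly I Ix]; case: (idealP I) => I0 ID IM //.
  by apply: ID; [apply: Ly | apply: Lz].
by apply: IM; apply: Ly.
Qed.

Definition ideal_gen (x : A) : ideal := Ideal (ideal_gen_subproof x).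

Definition ideal_pred (I : ideal) : {pred A} := fun x => `[< I x >].

Lemma ideal_pred_zmod I : zmod_closed (ideal_pred I).
Proof.
case: (idealP I) => I0 ID IM; split=> [|x y /asboolP Ix /asboolP Iy].
  exact/asboolP.
apply/asboolP/ID => //.
by have := IM (-1) y 1 Iy; rewrite mulr1 mulN1r.
Qed.

HB.instance Definition _ I :=
  GRing.isZmodClosed.Build A (ideal_pred I) (ideal_pred_zmod I).

End Ideals.

Definition quot_type (C : comNzRingType) (A : algebra C) (I : ideal A) : Type :=
  Quotient.quot (ideal_pred I).

Section AlgQuot.
Variables (C : comNzRingType) (A : algebra C) (I : ideal A).

Local Notation Q := (quot_type I).

HB.instance Definition _ := GRing.Zmodule.copy Q (Quotient.quot (ideal_pred I)).

Definition to_quot (x : A) : Q := (\pi_(Quotient.quot (ideal_pred I)) x)%qT.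
Definition of_quot (x : Q) : A := repr (x : Quotient.quot (ideal_pred I)).

Lemma of_quotK : cancel of_quot to_quot. Proof. exact: reprK. Qed.

Lemma to_quotP x y : to_quot x = to_quot y <-> I (x - y).
Proof.
have e := Quotient.idealrBE (ideal_pred I) x y.
split=> [/eqP h|/asboolP h].
  by apply/asboolP; change (x - y \in ideal_pred I); rewrite e.
by move: h; rewrite -[asbool _]/(x - y \in ideal_pred I) e => /eqP.
Qed.

Lemma to_quotD x y : to_quot (x + y) = to_quot x + to_quot y.
Proof. exact: Quotient.pi_add. Qed.

Definition quot_one : Q := to_quot 1.
Definition quot_mul (x y : Q) : Q := to_quot (of_quot x * of_quot y).
Definition quot_scale (c : C) (x : Q) : Q := to_quot (alg_scale c (of_quot x)).

Lemma of_quot_congr x : I (of_quot (to_quot x) - x).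
Proof. by apply/to_quotP; rewrite of_quotK. Qed.

Lemma to_quotM x y : to_quot (x * y) = quot_mul (to_quot x) (to_quot y).
Proof.
case: (idealP I) => _ ID IM; apply/esym/to_quotP.
set x' := of_quot _; set y' := of_quot _.
have -> : x' * y' - x * y = 1 * (x' - x) * y' + x * (y' - y) * 1.
  by rewrite mul1r mulr1 mulrBl mulrBr addrA subrK.
by apply: ID; apply: IM; apply: of_quot_congr.
Qed.

Lemma to_quotZ c x : to_quot (alg_scale c x) = quot_scale c (to_quot x).
Proof.
case: (idealP I) => _ _ IM; apply/esym/to_quotP.
set x' := of_quot _.
have scaleE z : alg_scale c z = alg_scale c 1 * z * 1.
  by rewrite mulr1 -alg_scaleAl mul1r.
rewrite [alg_scale c x']scaleE [alg_scale c x]scaleE !mulr1 -mulrBr.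
by rewrite -[X in I X]mulr1; apply: IM; apply: of_quot_congr.
Qed.

Lemma quot_mulA : associative quot_mul.
Proof.
move=> x y z; rewrite -(of_quotK x) -(of_quotK y) -(of_quotK z).
by rewrite -!to_quotM mulrA.
Qed.

Lemma quot_mul1 : left_id quot_one quot_mul.
Proof. by move=> x; rewrite -(of_quotK x) -to_quotM mul1r. Qed.

Lemma quot_mulr1 : right_id quot_one quot_mul.
Proof. by move=> x; rewrite -(of_quotK x) -to_quotM mulr1. Qed.

Lemma quot_mulDl : left_distributive quot_mul +%R.
Proof.
move=> x y z; rewrite -(of_quotK x) -(of_quotK y) -(of_quotK z).
by rewrite -to_quotD -!to_quotM -to_quotD mulrDl.
Qed.

Lemma quot_mulDr : right_distributive quot_mul +%R.
Proof.
move=> x y z; rewrite -(of_quotK x) -(of_quotK y) -(of_quotK z).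
by rewrite -to_quotD -!to_quotM -to_quotD mulrDr.
Qed.

HB.instance Definition _ := GRing.Zmodule_isPzRing.Build Q
  quot_mulA quot_mul1 quot_mulr1 quot_mulDl quot_mulDr.

Lemma quot_scaleA a b x : quot_scale a (quot_scale b x) = quot_scale (a * b) x.
Proof. by rewrite -(of_quotK x) -!to_quotZ alg_scaleA. Qed.

Lemma quot_scale1 x : quot_scale 1 x = x.
Proof. by rewrite -(of_quotK x) -to_quotZ alg_scale1. Qed.

Lemma quot_scaleDr a (x y : Q) :
  quot_scale a (x + y) = quot_scale a x + quot_scale a y.
Proof.
rewrite -(of_quotK x) -(of_quotK y) -to_quotD -!to_quotZ -to_quotD.
by rewrite alg_scaleDr.
Qed.

Lemma quot_scaleDl a b (x : Q) :
  quot_scale (a + b) x = quot_scale a x + quot_scale b x.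
Proof. by rewrite -(of_quotK x) -!to_quotZ -to_quotD alg_scaleDl. Qed.

Lemma quot_scaleAl a (x y : Q) : quot_scale a (x * y) = quot_scale a x * y.
Proof.
rewrite -(of_quotK x) -(of_quotK y) -[_ * _]to_quotM -!to_quotZ.
by rewrite -[RHS]to_quotM alg_scaleAl.
Qed.

Lemma quot_scaleAr a (x y : Q) : quot_scale a (x * y) = x * quot_scale a y.
Proof.
rewrite -(of_quotK x) -(of_quotK y) -[_ * _]to_quotM -!to_quotZ.
by rewrite -[RHS]to_quotM alg_scaleAr.
Qed.

Definition alg_quot : algebra C :=
  @Algebra C Q quot_scale quot_scaleA quot_scale1 quot_scaleDr quot_scaleDl
    quot_scaleAl quot_scaleAr.

Definition quot_pi (x : A) : alg_quot := to_quot x.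

End AlgQuot.

Section Dihedral.

(* The pair (a, b) stands for r^a s^b. *)
Definition dihedral (n : nat) : predArgType := ('Z_n * bool)%type.

HB.instance Definition _ n := Finite.on (dihedral n).

Variable n : nat.
Local Notation D := (dihedral n).

Definition dih_one : D := (0, false).
Definition dih_mul (x y : D) : D :=
  (x.1 + (if x.2 then - y.1 else y.1), x.2 (+) y.2).
Definition dih_inv (x : D) : D := (if x.2 then x.1 else - x.1, x.2).

Lemma dih_mulA : associative dih_mul.
Proof.
move=> [a []] [b []] [c d]; rewrite /dih_mul /= ?addrA ?negbK //.
- by rewrite opprB addrA addrAC.
- by rewrite opprD addrA.
Qed.

Lemma dih_mul1 : left_id dih_one dih_mul.
Proof. by case=> a b; rewrite /dih_mul /= add0r. Qed.

Lemma dih_mulV : left_inverse dih_one dih_inv dih_mul.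
Proof. by case=> a []; rewrite /dih_mul /= ?subrr ?addNr. Qed.

HB.instance Definition _ :=
  Finite_isGroup.Build D dih_mulA dih_mul1 dih_mulV.

Definition dih_r : D := (1, false).
Definition dih_s : D := (0, true).

Lemma dih_rX k : (dih_r ^+ k)%g = (k%:R, false) :> D.
Proof.
elim: k => // k IHk.
by rewrite expgS IHk mulrS.
Qed.

Lemma dih_elt (x : D) : x = (dih_r ^+ x.1 * dih_s ^+ x.2)%g.
Proof.
case: x => a b; rewrite dih_rX /= natr_Zp.
case: b; rewrite ?expg1 ?expg0 ?mulg1 //.
by congr pair; rewrite addr0.
Qed.

Lemma dih_presentation : (2 < n)%N ->
  [/\ (dih_r ^+ n = 1)%g, (dih_s ^+ 2 = 1)%g,
      (dih_s * dih_r * dih_s = dih_r^-1)%g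
    & #|{: D}| = (2 * n)%N].
Proof.
move=> n_gt2; have n_gt1 : (1 < n)%N by apply: ltnW.
split.
- by rewrite dih_rX char_Zp.
- by rewrite expgS expg1; congr pair; rewrite oppr0 addr0.
- by congr pair; rewrite /= oppr0 addr0 add0r.
- by rewrite card_prod card_bool card_ord Zp_cast // mulnC.
Qed.

End Dihedral.

Definition dih_index := {n : nat | (2 < n)%N}.

Section Embedding.
Variables (m n : dih_index) (m_dvd_n : (val m %| val n)%N).

Let q := (val n %/ val m)%N.

Definition dih_emb_fun (x : dihedral (val m)) : dihedral (val n) :=
  ((q * x.1)%:R, x.2).

Let m_gt1 : (1 < val m)%N. Proof. exact: ltnW (valP m). Qed.
Let n_gt1 : (1 < val n)%N. Proof. exact: ltnW (valP n). Qed.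
Let nE : val n = (q * val m)%N. Proof. by rewrite divnK. Qed.
Let q_gt0 : (0 < q)%N.
Proof. by move: n_gt1; rewrite nE; case: (q). Qed.

Let emb_nat (a : nat) : (q * (a %% val m))%:R = (q * a)%:R :> 'Z_(val n).
Proof. by rewrite muln_modr -nE Zp_nat_mod. Qed.

Let emb_add (a b : 'Z_(val m)) :
  (q * (a + b)%R)%:R = (q * a)%:R + (q * b)%:R :> 'Z_(val n).
Proof.
have -> : (a + b)%R = ((a + b)%N %% val m)%N :> nat.
  by congr (_ %% _)%N; apply: Zp_cast.
by rewrite emb_nat mulnDr natrD.
Qed.

Let emb_opp (a : 'Z_(val m)) : (q * (- a)%R)%:R = - (q * a)%:R :> 'Z_(val n).
Proof. by apply/eqP; rewrite -addr_eq0 -emb_add addNr muln0. Qed.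

Lemma dih_emb_morphism :
  {in [set: dihedral (val m)] &,
     {morph dih_emb_fun : x y / (x * y)%g}}.
Proof.
move=> [a b] [c d] _ _; congr pair.
case: b; apply: etrans (emb_add _ _) _ => //.
by congr (_ + _); apply: emb_opp.
Qed.

Definition dih_emb : {morphism [set: dihedral (val m)] >-> dihedral (val n)} :=
  Morphism dih_emb_morphism.

Lemma dih_emb_r : dih_emb (dih_r (val m)) = (dih_r (val n) ^+ q)%g.
Proof.
rewrite dih_rX; congr pair => /=.
by rewrite (_ : 1 %% _ = 1)%N ?muln1 // modn_small.
Qed.

Lemma dih_emb_s : dih_emb (dih_s (val m)) = dih_s (val n).
Proof. by congr pair; rewrite /= muln0. Qed.

Lemma dih_emb_inj : ('injm dih_emb)%g.
Proof.
apply/injmP => -[a b] [c d] _ _ [/eqP e ->]; congr pair.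
have lt_n (x : 'Z_(val m)) : (q * x < val n)%N.
  by rewrite nE ltn_pmul2l // -[X in (_ < X)%N](Zp_cast m_gt1) ltn_ord.
apply/val_inj/eqP; move: e.
rewrite -val_eqE /= !val_Zp_nat // !modn_small // eqn_pmul2l //.
Qed.

End Embedding.

Section Induction.
Variables (C : fieldType) (aT gT : finGroupType).
Variables (f : {morphism [set: aT] >-> gT}) (injf : ('injm f)%g).
Variables (d : nat) (rH : mx_representation C [set: aT]%G d).

Let H : {group gT} := (f @* [set: aT])%G.

(* rH extended by 0 outside the image of f *)
Definition ext0_mx (x : gT) : 'M[C]_d :=
  if x \in (f @* [set: aT])%g then rH (invm injf x) else 0.

Definition coset_rep (i : 'I_#|rcosets H [set: gT]|) : gT :=
  fingroup.repr (enum_val i).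

(* The induced representation in block form: block (i, j) of g is
   rH (t_i g t_j^-1), extended by 0, for a transversal t of the right cosets.
   Since matrices multiply as group elements, this is a homomorphism, and
   similarity classes do not depend on t. *)
Definition ind_mx (g : gT) :
    'M[C]_(\sum_(i < #|rcosets H [set: gT]|) d) :=
  \mxblock_(i, j) ext0_mx (coset_rep i * g * (coset_rep j)^-1)%g.

Lemma ext0_mxM (h x : gT) : h \in (f @* [set: aT])%g ->
  ext0_mx (h * x)%g = ext0_mx h *m ext0_mx x.
Proof.
move=> Hh; rewrite /ext0_mx Hh groupMl //; case: ifP => Hx; last by rewrite mulmx0.
by rewrite morphM // repr_mxM.
Qed.

Lemma ext0_mx1 : ext0_mx 1%g = 1%:M.
Proof. by rewrite /ext0_mx group1 morph1 repr_mx1. Qed.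

Lemma coset_repE i : (H :* coset_rep i)%g = enum_val i.
Proof.
have /rcosetsP[x _ e] := enum_valP i.
by rewrite /coset_rep e; apply: rcoset_repr.
Qed.

Lemma coset_rep_eq i j :
  ((coset_rep i * (coset_rep j)^-1)%g \in (f @* [set: aT])%g) = (i == j).
Proof.
rewrite -mem_rcoset -[(_ @* _)%g]/(gval H).
apply/idP/eqP => [/rcoset_eqP e | ->]; last exact: rcoset_refl.
by apply: enum_val_inj; rewrite -!coset_repE e.
Qed.

Lemma coset_rep_ex (x : gT) :
  exists i, (x * (coset_rep i)^-1)%g \in (f @* [set: aT])%g.
Proof.
have Hx : (H :* x)%g \in rcosets H [set: gT] by apply/rcosetsP; exists x.
exists (enum_rank_in Hx (H :* x)%g).
rewrite -mem_rcoset -[(_ @* _)%g]/(gval H) coset_repE enum_rankK_in //.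
exact: rcoset_refl.
Qed.

Lemma ind_mx_repr : mx_repr [set: gT]%G ind_mx.
Proof.
split=> [|g h _ _].
  rewrite -mxdiagZ; apply/eq_mxblock => i j; rewrite mulg1 conform_mx_id.
  case: eqP => [-> | /eqP ne_ij]; first by rewrite mulgV ext0_mx1.
  by rewrite /ext0_mx coset_rep_eq (negbTE ne_ij).
rewrite /ind_mx mul_mxblock; apply/eq_mxblock => i k.
have [j Hj] := coset_rep_ex (coset_rep i * g)%g.
rewrite (bigD1 j) //= big1 ?addr0 => [|j' neq_j]; last first.
  rewrite {1}/ext0_mx ifF ?mul0mx //; apply: contraNF neq_j => Hj'.
  rewrite -coset_rep_eq; have := groupM (groupVr Hj') Hj.
  by rewrite invMg invgK mulgA mulgKV.
by rewrite -ext0_mxM //; congr ext0_mx; rewrite !mulgA mulgKV.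
Qed.

Definition ind_repr := MxRepresentation ind_mx_repr.

Definition res_repr (n : nat) (rG : mx_representation C [set: gT]%G n) :
    mx_representation C [set: aT]%G n :=
  morphim_repr (subg_repr rG (finset.subsetT (f @* [set: aT])%G)) (subxx _).

End Induction.

Section Grothendieck.
Variable C : numClosedFieldType.

Definition dih_irr (n : nat) : irrType C [set: dihedral n]%G :=
  DecSocleType (regular_repr C [set: dihedral n]%G).

(* irrType indexes the isomorphism classes of irreducible representations, so
   this is the set of isomorphism classes of simple D_2n-modules, n >= 3. *)
Definition simples : choiceType := {n : dih_index & dih_irr (val n)}.

Definition simple_mod (n : dih_index) (i : dih_irr (val n)) : simples :=
  Tagged (fun m : dih_index => dih_irr (val m)) i.

Definition groth : lmodType C := {malg C[simples]}.

Definition simple_class (k : simples) : groth := << k >>.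

(* By Maschke's theorem the module is the direct sum of its isotypic components
   W, and W is isomorphic to (socle_base W)^(socle_mult W). *)
Definition module_class (n : dih_index) (d : nat)
    (rG : mx_representation C [set: dihedral (val n)]%G d) : groth :=
  \sum_(W : DecSocleType rG)
     (socle_mult W)%:R *:
       simple_class (simple_mod (irr_comp (dih_irr (val n)) (socle_repr W))).

Lemma module_class_simple (n : dih_index) (i : dih_irr (val n)) :
  module_class (irr_repr i) = simple_class (simple_mod i).
Proof.
have pc : pgroup (negn [pchar C]) [set: dihedral (val n)].
  by apply/pgroupP => p _ _; apply/negP; rewrite Num.Theory.pchar_num.
have irr : mx_irreducible (irr_repr i) by apply: socle_irr.
rewrite /module_class.
have base (W : DecSocleType (irr_repr i)) : (socle_base W :=: 1%:M)%MS.
  have [modW nzW _] := socle_simple W.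
  have [_ _ h] := irr.
  by apply/eqmxP; rewrite submx1 h ?submx1.
have rs (W : DecSocleType (irr_repr i)) : mx_rsim (socle_repr W) (irr_repr i).
  exact: rsim_submod1.
have W0 : DecSocleType (irr_repr i) := PackSocle (component_socle _ irr).
rewrite (bigD1 W0) //= big1 ?addr0 => [|W /eqP[]]; last first.
  by apply/eqP/socle_rsimP; apply: mx_rsim_trans (rs W) (mx_rsim_sym (rs W0)).
rewrite (irr_comp_rsim_pchar _ _ (rs W0)) // irr_reprK_pchar //.
suff -> : socle_mult W0 = 1%N by rewrite scale1r.
rewrite /socle_mult.
have sub : (socle_base W0 <= W0)%MS by apply: component_mx_id; apply: socle_simple.
have -> : \rank W0 = \rank (socle_base W0).
  apply/eqP; rewrite eqn_leq (mxrankS sub) andbT base mxrank1; apply: rank_leq_row.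
by rewrite divnn lt0n mxrank_eq0; case: (socle_simple W0) => _ -> _.
Qed.

Definition lin_ext (K : choiceType) (V : lmodType C) (f : K -> V)
    (x : {malg C[K]}) : V :=
  \sum_(k <- msupp x) x@_k *: f k.

Definition prime_nat := {p : nat | prime p}.

Lemma ind_index_subproof (p : prime_nat) (n : dih_index) :
  (2 < val p * val n)%N.
Proof.
by apply: leq_trans (valP n) _; rewrite leq_pmull // prime_gt0 // (valP p).
Qed.

Definition ind_index (p : prime_nat) (n : dih_index) : dih_index :=
  exist _ (val p * val n)%N (ind_index_subproof p n).

Lemma dvdn_ind_index p n : (val n %| val (ind_index p n))%N.
Proof. exact: dvdn_mull. Qed.

Definition ind_simple (p : prime_nat) (k : simples) : groth :=
  module_class (n := ind_index p (tag k))
    (ind_repr (dih_emb_inj (dvdn_ind_index p (tag k))) (irr_repr (tagged k))).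

Definition res_ok (p : prime_nat) (n : dih_index) : bool :=
  (val p %| val n)%N && (2 < val n %/ val p)%N.

Definition res_index p n (h : res_ok p n) : dih_index :=
  exist _ (val n %/ val p)%N (andP h).2.

Lemma dvdn_res_index p n (h : res_ok p n) : (val (res_index h) %| val n)%N.
Proof. by apply: dvdn_div; case/andP: h. Qed.

Definition res_simple (p : prime_nat) (k : simples) : groth :=
  if @idP (res_ok p (tag k)) is ReflectT h then
    module_class (n := res_index h)
      (res_repr (dih_emb (dvdn_res_index h)) (irr_repr (tagged k)))
  else 0.

Definition Ind (p : prime_nat) : groth -> groth := lin_ext (ind_simple p).
Definition Res (p : prime_nat) : groth -> groth := lin_ext (res_simple p).

Section LinExt.
Variables (K : choiceType) (V : lmodType C) (f : K -> V).

Lemma lin_extEw (d : {fset K}) (x : {malg C[K]}) : (msupp x `<=` d)%fset ->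
  lin_ext f x = \sum_(k <- d) x@_k *: f k.
Proof.
move=> le; rewrite [LHS](big_fset_incl _ le) => //= k kd /mcoeff_outdom ->.
by rewrite scale0r.
Qed.

Lemma lin_ext_is_linear : linear (lin_ext f).
Proof.
move=> a x y; pose d := (msupp x `|` msupp y)%fset.
rewrite (@lin_extEw d (a *: x + y)); last first.
  apply: fsubset_trans (msuppD_le _ _) _; apply: fsetUSS (fsubset_refl _).
  exact: msuppZ_le.
rewrite (@lin_extEw d x) ?fsubsetUl // (@lin_extEw d y) ?fsubsetUr //.
rewrite scaler_sumr -big_split /=; apply: eq_bigr => k _.
by rewrite mcoeffD mcoeffZ scalerDl scalerA.
Qed.

HB.instance Definition _ :=
  GRing.isLinear.Build C {malg C[K]} V _ (lin_ext f) lin_ext_is_linear.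

Lemma lin_extU a k : lin_ext f << a *g k >> = a *: f k.
Proof. by rewrite (lin_extEw msuppU_le) big_seq_fset1 mcoeffUU. Qed.

End LinExt.

HB.instance Definition _ p := GRing.Linear.copy (Ind p) (lin_ext (ind_simple p)).
HB.instance Definition _ p := GRing.Linear.copy (Res p) (lin_ext (res_simple p)).

Section FreeAlgebra.
Variable P : set prime_nat.

Inductive letter := ResL of P | IndL of P.

Definition letter_code (l : letter) : P + P :=
  match l with ResL p => inl p | IndL p => inr p end.
Definition letter_decode (l : P + P) : letter :=
  match l with inl p => ResL p | inr p => IndL p end.
Lemma letter_codeK : cancel letter_code letter_decode. Proof. by case. Qed.

HB.instance Definition _ := Choice.copy letter (can_type letter_codeK).

Definition free_ring := {malg C[{fmonom letter}]}.
HB.instance Definition _ := GRing.Lalgebra.on free_ring.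

Lemma free_ring_scaleAr (a : C) (x y : free_ring) :
  a *: (x * y) = x * (a *: y).
Proof.
have mulC z : z * (a%:MP : {malg C[{fmonom letter}]}) = a *: z.
  rewrite malgM_def fgmulgU malgZ_def; apply: eq_bigr => k _.
  by rewrite mulm1 mulrC.
by rewrite -(mul_malgC a y) [RHS]mulrA mulC scalerAl.
Qed.

HB.instance Definition _ :=
  GRing.Lalgebra_isAlgebra.Build C free_ring free_ring_scaleAr.

Definition freeA : algebra C := algebra_of_algType free_ring.

Definition gen_letter (l : letter) : freeA :=
  (<< FMonom [:: l] >> : {malg C[{fmonom letter}]}).
Definition gen_res (p : P) : freeA := gen_letter (ResL p).
Definition gen_ind (p : P) : freeA := gen_letter (IndL p).

Definition letter_op (l : letter) : groth -> groth :=
  match l with ResL p => Res (val p) | IndL p => Ind (val p) end.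

Definition word_op (w : {fmonom letter}) (x : groth) : groth :=
  foldr letter_op x w.

(* A word acts as the composite of its letters, the last letter first. *)
Definition act (a : freeA) (x : groth) : groth :=
  lin_ext (word_op^~ x) a.

Lemma letter_op_linear l : linear (letter_op l).
Proof. by case: l => p; apply: linearP. Qed.

Lemma word_op_linear w : linear (word_op w).
Proof.
move=> a x y; rewrite /word_op; elim: (fmonom_val w) => //= l s ->.
exact: letter_op_linear.
Qed.

Lemma act_linear a : linear (act a).
Proof.
move=> c x y; rewrite /act /lin_ext scaler_sumr -big_split /=.
by apply: eq_bigr => w _; rewrite word_op_linear scalerDr !scalerA mulrC.
Qed.

HB.instance Definition _ a :=
  GRing.isLinear.Build C groth groth _ (act a) (act_linear a).

Lemma actD a b x : act (a + b) x = act a x + act b x.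
Proof. by rewrite /act -raddfD. Qed.

Lemma act_monom c w x : act (<< c *g w >> : free_ring) x = c *: word_op w x.
Proof. exact: lin_extU. Qed.

Lemma act1 x : act 1 x = x.
Proof.
rewrite -[1 : freeA]/(<< (1 : C) *g (mone : {fmonom letter}) >> : free_ring).
rewrite act_monom scale1r.
by rewrite /word_op fm1.
Qed.

Lemma word_opM v w x : word_op (mmul v w) x = word_op v (word_op w x).
Proof. by rewrite /word_op fmM foldr_cat. Qed.

Lemma actM a b x : act (a * b) x = act a (act b x).
Proof.
have actE : act a (act b x) = \sum_(v <- msupp (a : free_ring))
    a@_v *: word_op v (act b x) by [].
rewrite actE -[a * b : freeA]/((a : free_ring) * (b : free_ring)) malgME.
rewrite /act linear_sum; apply: eq_bigr => v _.
have wlin : word_op v (lin_ext (word_op^~ x) b)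
  = \sum_(w <- msupp (b : free_ring)) b@_w *: word_op v (word_op w x).
  rewrite /lin_ext.
  elim/big_rec2: _ => [|w y z _ <-].
    by have := word_op_linear v (-1) 0 0; rewrite scaler0 addr0 scaleN1r addNr.
  exact: word_op_linear.
rewrite wlin linear_sum scaler_sumr; apply: eq_bigr => w _ /=.
by rewrite lin_extU word_opM scalerA.
Qed.

Definition is_submodule (M : set groth) : Prop :=
  [/\ M 0,
      forall x y, M x -> M y -> M (x + y)
    & forall a x, M x -> M (act a x)].

Record submodule := Submodule {
  submodule_set :> groth -> Prop;
  submoduleP : is_submodule submodule_set
}.

Definition Ann_set (M : submodule) : set freeA :=
  [set a | forall x, M x -> act a x = 0]%classic.

Lemma Ann_subproof M : two_sided_ideal (Ann_set M).
Proof.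
case: (submoduleP M) => _ _ MA; split=> [x _|a b Aa Ab x Mx|a b c Ab x Mx].
- by rewrite /act raddf0.
- by rewrite actD Aa // Ab // addr0.
by rewrite !actM Ab ?raddf0 //; apply: MA.
Qed.

Definition Ann (M : submodule) : ideal freeA := Ideal (Ann_subproof M).

Definition quotA (M : submodule) : algebra C := alg_quot (Ann M).

Definition quot_res (M : submodule) (p : P) : quotA M := quot_pi (Ann M) (gen_res p).
Definition quot_ind (M : submodule) (p : P) : quotA M := quot_pi (Ann M) (gen_ind p).

End FreeAlgebra.

Definition lspan (V : lmodType C) (S : set V) : set V :=
  [set v | exists (m : nat) (c : 'I_m -> C) (b : 'I_m -> V),
     (forall i, S (b i)) /\ v = \sum_(i < m) c i *: b i]%classic.

Definition spanned_by_odd_simples (M : set groth) : Prop :=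
  exists B : set simples,
    (forall k, B k -> odd (val (tag k))) /\
    (M = lspan (simple_class @` B))%classic.

Definition all_or_none (M : set groth) : Prop :=
  forall n : dih_index,
    (forall i : dih_irr (val n), M (simple_class (simple_mod i))) \/
    (forall i : dih_irr (val n), ~ M (simple_class (simple_mod i))).

End Grothendieck.

(* Main.v *)
From HB Require Import structures.
Require Import Defs.
From mathcomp Require Import all_boot all_order all_algebra.
From mathcomp Require Import all_fingroup all_character.
From mathcomp Require Import finmap.
From mathcomp Require Import boolp classical_sets reals.
From mathcomp.real_closed Require Import complex.
From mathcomp.multinomials Require Import monalg.

Set Implicit Arguments.
Unset Strict Implicit.
Unset Printing Implicit Defensive.

Import GRing.Theory.

Local Open Scope ring_scope.
Local Open Scope complex_scope.

(** A class in the Grothendieck group is determined by the traces of its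
    components, and for n odd the trace of a D_2n-module is given by its values
    on the rotations r^a and its single value on the reflections.  On traces,
    restriction and induction along q become

    - on rotations:   (Res_q f)_n (a) = f_(qn) (qa), and
                      (Ind_q f)_n (a) = q * f_(n/q) (a/q) if q | n and q | a,
                      and 0 otherwise;
    - on reflections: the same formulas with argument a = 0 and factor 1
                      instead of q;

    with the convention that all traces vanish at the levels n < 3 [coord_Ind,
    coord_Res].  So M has two submodules: the piece where the traces of
    reflections vanish, and the piece where the traces of rotations vanish.
    On them Res_q Ind_q is q and 1 respectively.  As these numbers
    differ, imposing Res_p Ind_p = p, or Res_p Ind_p = 1, on the image of the
    free algebra in End(M) gives exactly its image in the endomorphisms of the
    first, or second, piece [to_quotient_eq0_act, act_eq0_to_quotient].  It
    remains to see that a central idempotent of the latter algebra is 0 or 1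
    [central_idempotent_piece].

    Let a act on a piece as a central idempotent.  Res_q undoes Ind_q, hence
    after enough inductions Ind_t no restriction in a word of a reaches
    the bottom levels, and a Ind_t is a finite sum T = sum_m d_m S_m of pure
    shifts, where (S_m y)_n (i) = y_(n/m) (i/m) [act_shift_sum].  Up to a
    nonzero factor k, Ind_t is S_t.  As a is idempotent and commutes with Ind_t,
    we have T T = a Ind_t Ind_t = T (k S_t).  Since S_m S_m' = S_mm', comparing
    the highest levels and then the lowest ones shows that the largest and the
    smallest m with d_m <> 0 are both equal to t, so that d = 0 or
    T = k S_t = Ind_t [shift_sum_idempotent].  In the first case
    Ind_t a = a Ind_t = 0, in the second Ind_t a = Ind_t; as Ind_t is injective,
    a = 0 or a = 1 on the piece. *)

Local Notation act := Defs.act.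

(** * Traces of induced representations *)

Section Traces.
Variable F : fieldType.

Lemma mxtrace_conjg (gT : finGroupType) d
    (rG : mx_representation F [set: gT]%G d) (t x : gT) :
  \tr (rG (t * x * t^-1)%g) = \tr (rG x).
Proof.
rewrite !repr_mxM ?groupM ?inE // mxtrace_mulC mulmxA -repr_mxM ?inE //.
by rewrite mulVg repr_mx1 mul1mx.
Qed.

Variables (aT gT : finGroupType) (f : {morphism [set: aT] >-> gT}).
Variables (injf : ('injm f)%g) (d : nat).
Variable rH : mx_representation F [set: aT]%G d.

Lemma ext0_mx_morph x : ext0_mx injf rH (f x) = rH x.
Proof. by rewrite /ext0_mx mem_morphim ?inE // invmE ?inE. Qed.

Lemma ext0_mx_out y : y \notin (f @* [set: aT])%g -> ext0_mx injf rH y = 0.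
Proof. by rewrite /ext0_mx => /negbTE ->. Qed.

Lemma mxtrace_ind g :
  \tr (ind_repr injf rH g) =
  \sum_i \tr
    (ext0_mx injf rH
       (coset_rep (f := f) i * g * (coset_rep (f := f) i)^-1)%g).
Proof. exact: mxtrace_mxblock. Qed.

Lemma mxtrace_res n (rG : mx_representation F [set: gT]%G n) x :
  \tr (res_repr f rG x) = \tr (rG (f x)).
Proof. by []. Qed.

End Traces.

(** * Conjugation and induction in dihedral groups *)

Section DihedralGroups.

Lemma dih_conj_s n (c : 'Z_n) (e : bool) :
  (((c, e) : dihedral n) * dih_s n * ((c, e) : dihedral n)^-1)%g =
    (c + c, true).
Proof.
by case: e; congr pair; rewrite /= ?oppr0 ?addr0 ?add0r ?opprK.
Qed.

Lemma dih_conj_r n (c a : 'Z_n) (e : bool) :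
  (((c, e) : dihedral n) * ((a, false) : dihedral n) *
    ((c, e) : dihedral n)^-1)%g =
    (if e then - a else a, false).
Proof.
case: e; congr pair => /=; first by rewrite addrAC subrr add0r.
by rewrite addrAC subrr add0r.
Qed.

(** All reflections of a regular polygon with an odd number of vertices are
    conjugate, because 2 is invertible modulo an odd number. *)
Lemma dih_reflection_conj n (a : 'Z_n) : odd n -> (1 < n)%N ->
  exists t : dihedral n, (t * dih_s n * t^-1)%g = (a, true).
Proof.
move=> oddn n_gt1; pose c : 'Z_n := a *+ (n.+1)./2.
exists (c, false); rewrite dih_conj_s; congr pair.
rewrite /c -mulr2n -mulrnA muln2 -[in RHS](mulr1n a).
have -> : ((n.+1)./2).*2 = n.+1 by rewrite -[RHS]odd_double_half /= oddn.
by rewrite mulrS -mulr_natr pchar_Zp // mulr0 addr0 mulr1n.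
Qed.

Variables (m n : dih_index) (m_dvd_n : (val m %| val n)%N).
Local Notation emb := (dih_emb m_dvd_n).
Local Notation H := (emb @* [set: dihedral (val m)])%g.
Local Notation q := (val n %/ val m)%N.

Let n_gt1 : (1 < val n)%N. Proof. exact: ltnW (valP n). Qed.
Let m_gt1 : (1 < val m)%N. Proof. exact: ltnW (valP m). Qed.
Let q_dvd_n : (q %| val n)%N. Proof. by rewrite dvdn_div. Qed.
Let q_dvd_modn x : (q %| x %% val n)%N = (q %| x)%N.
Proof. by rewrite /dvdn modn_dvdm. Qed.

Lemma dih_emb_rs a e :
  emb (dih_r (val m) ^+ a * dih_s (val m) ^+ e)%g =
  (dih_r (val n) ^+ (q * a) * dih_s (val n) ^+ e)%g.
Proof.
by rewrite morphM ?inE // !morphX ?inE // dih_emb_r dih_emb_s expgM.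
Qed.

Lemma mem_dih_emb (y : dihedral (val n)) : (y \in H) = (q %| y.1)%N.
Proof.
apply/morphimP/idP => [[[a e] _ _ ->]|q_dvd].
  rewrite /= /dih_emb_fun /= val_Zp_nat //.
  by rewrite q_dvd_modn dvdn_mulr.
exists (dih_r (val m) ^+ (y.1 %/ q) * dih_s (val m) ^+ y.2)%g; rewrite ?inE //.
by rewrite dih_emb_rs mulnC divnK // -dih_elt.
Qed.

Lemma card_rcosets_dih_emb : #|rcosets H [set: dihedral (val n)]| = q.
Proof.
rewrite -[LHS]/(#|[set: dihedral (val n)] : H|)%g.
rewrite -divgS ?finset.subsetT // card_injm ?dih_emb_inj ?finset.subsetT //.
rewrite !cardsT.
have [_ _ _ ->] := dih_presentation (valP n).
have [_ _ _ ->] := dih_presentation (valP m).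
by rewrite divnMl.
Qed.

Variables (F : fieldType) (d : nat).
Variable rH : mx_representation F [set: dihedral (val m)]%G d.
Local Notation rG := (ind_repr (dih_emb_inj m_dvd_n) rH).

(** Rotations form a normal subgroup, so a rotation r^a of the big group is
    conjugate into the subgroup either by all coset representatives (when the
    index q divides a) or by none; conjugation only changes a into -a. *)
Lemma mxtrace_ind_rot a :
  \tr (rG (dih_r (val n) ^+ a)%g) =
  if (q %| a)%N then q%:R * \tr (rH (dih_r (val m) ^+ (a %/ q))%g) else 0.
Proof.
rewrite mxtrace_ind.
have q_dvd_ra :
    (q %| ((dih_r (val n) ^+ a)%g : dihedral (val n)).1)%N = (q %| a)%N.
  by rewrite dih_rX /= val_Zp_nat // q_dvd_modn.
case: ifPn => [/divnK qa | q_ndvd].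
  rewrite (eq_bigr (fun=> \tr (rH (dih_r (val m) ^+ (a %/ q))%g))).
    by rewrite sumr_const card_ord card_rcosets_dih_emb mulr_natl.
  move=> i _; case: (coset_rep i) => c e.
  rewrite dih_rX dih_conj_r.
  pose b := (a %/ q)%N.
  have -> : (if e then - a%:R else a%:R, false) =
      emb (((0, e) : dihedral (val m)) * dih_r (val m) ^+ b *
           ((0, e) : dihedral (val m))^-1)%g.
    have -> : ((0, e) : dihedral (val m)) =
        (dih_r (val m) ^+ 0 * dih_s (val m) ^+ e)%g.
      by rewrite expg0 mul1g; case: (e).
    rewrite !(morphM, morphV, morphX) ?inE // dih_emb_r dih_emb_s.
    rewrite expg0 mul1g -expgM [(q * b)%N]mulnC qa.
    have -> : (dih_s (val n) ^+ e)%g = (0, e) by case: (e).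
    by rewrite dih_rX dih_conj_r.
  by rewrite ext0_mx_morph mxtrace_conjg.
apply: big1 => i _; rewrite ext0_mx_out ?linear0 //.
rewrite mem_dih_emb; apply: contra q_ndvd => qd; rewrite -q_dvd_ra; move: qd.
case: (coset_rep i) => c [] ; rewrite dih_rX dih_conj_r //=.
set x := _%:R; have lt_x : (x < val n)%N.
  by rewrite -[X in (_ < X)%N](Zp_cast n_gt1).
move: (x : nat) lt_x => {}x lt_x; rewrite Zp_cast //.
by rewrite q_dvd_modn dvdn_subr // ltnW.
Qed.

(** A reflection r^a s lies in the subgroup exactly when the index q divides
    a; conjugation by r^c moves s to r^(2c) s, so for q odd the only coset
    fixed by s is the subgroup itself. *)
Lemma mxtrace_ind_refl : odd q ->
  \tr (rG (dih_s (val n))) = \tr (rH (dih_s (val m))).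
Proof.
move=> oddq; rewrite mxtrace_ind.
have [i0] := coset_rep_ex emb 1%g; rewrite mul1g groupV => Hi0.
have inH t : ((t * dih_s (val n) * t^-1)%g \in H) = (t \in H).
  case: t => c e; rewrite dih_conj_s !mem_dih_emb /=.
  move: (c : nat) => {}c.
  rewrite Zp_cast // q_dvd_modn addnn -mul2n Gauss_dvdr //.
  by rewrite coprimen2.
rewrite (bigD1 i0) //= big1 ?addr0 => [|i neq_i]; last first.
  rewrite ext0_mx_out ?linear0 // inH; apply: contra neq_i => Hi.
  by rewrite -coset_rep_eq groupM // groupV.
case/morphimP: Hi0 => t _ _ ->.
have -> : (emb t * dih_s (val n) * (emb t)^-1)%g =
    emb (t * dih_s (val m) * t^-1)%g.
  by rewrite !morphM ?inE // morphV ?inE // dih_emb_s.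
by rewrite ext0_mx_morph mxtrace_conjg.
Qed.

End DihedralGroups.

(** * Traces on the Grothendieck group *)

Section LinearOnMalg.
Variables (C : numClosedFieldType) (K : choiceType) (V : lmodType C).
Implicit Types x : {malg C[K]}.

Lemma linear_malgE (f : {linear {malg C[K]} -> V}) x :
  f x = \sum_(k <- msupp x) x@_k *: f << k >>.
Proof.
rewrite [in LHS](monalgE x) linear_sum; apply: eq_bigr => k _.
rewrite -linearZ; congr (f _); apply/malgP => k'.
by rewrite mcoeffZ !mcoeffU mulrnAr mulr1.
Qed.

Lemma linear_malg_ext (f g : {linear {malg C[K]} -> V}) x :
  (forall k, k \in msupp x -> f << k >> = g << k >>) -> f x = g x.
Proof.
move=> fg; rewrite linear_malgE [RHS]linear_malgE !big_seq.
by apply: eq_bigr => k /fg ->.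
Qed.

End LinearOnMalg.

Section TraceFunctionals.
Variable C : numClosedFieldType.
Implicit Types (x : groth C) (k : simples C).

Lemma dih_pgroup n : pgroup.pgroup [char C]^' [set: dihedral n]%G.
Proof.
by apply/pgroup.pgroupP => r _ _; apply/negP; rewrite Num.Theory.pchar_num.
Qed.

(** The group element is given as a family over all dihedral groups, so that the
    value at a basis element can be read in the group of its own level. *)
Definition level_trace (n : nat) (g : forall m, dihedral m) :
    groth C -> C^o :=
  lin_ext (V := C^o) (fun k => if val (tag k) == n
                    then \tr (irr_repr (tagged k) (g (val (tag k)))) else 0).

HB.instance Definition _ n g :=
  GRing.Linear.copy (level_trace n g) (lin_ext _).

Lemma level_traceU n g k :
  level_trace n g (simple_class k) =
  if val (tag k) == n then \tr (irr_repr (tagged k) (g (val (tag k)))) else 0.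
Proof. by rewrite /level_trace lin_extU scale1r. Qed.

(** By complete reducibility a module is the sum of the simple modules in its
    class, with the same multiplicities, and traces add up. *)
Lemma level_trace_class (n : dih_index) d m g
    (rG : mx_representation C [set: dihedral (val n)]%G d) :
  level_trace m g (module_class rG) =
  if val n == m then \tr (rG (g (val n))) else 0.
Proof.
rewrite /module_class linear_sum /=; case: ifP => nm; last first.
  apply: big1 => W _; rewrite linearZ /= level_traceU nm.
  exact: mulr0.
pose sG := DecSocleType rG.
have Soc1 : (Socle sG :=: 1%:M)%MS.
  rewrite reducible_Socle1 //; apply: mx_Maschke_pchar; exact: dih_pgroup.
rewrite -(mxtrace_submod1 (Socle_module sG) Soc1) ?inE // mxtrace_Socle ?inE //.
apply: eq_bigr => W _; rewrite linearZ /= level_traceU nm.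
rewrite -[in RHS]mulr_natl; congr (_ * _).
have rs := rsim_irr_comp_pchar (dih_irr C (val n)) (dih_pgroup (val n))
  (socle_irr W).
by rewrite (mxtrace_rsim rs) ?inE.
Qed.

Definition rotation (a m : nat) : dihedral m := (dih_r m ^+ a)%g.

Definition reflection (m : nat) : dihedral m := dih_s m.

Lemma Ind_simple q k : Ind q (simple_class k) = ind_simple q k.
Proof. by rewrite /Ind lin_extU scale1r. Qed.

Lemma Res_simple q k : Res q (simple_class k) = res_simple q k.
Proof. by rewrite /Res lin_extU scale1r. Qed.

Lemma ind_index_div q n : (val (ind_index q n) %/ val n = val q)%N.
Proof. by rewrite mulnK // ltnW // ltnW // (valP n). Qed.

Lemma level_trace_Ind_simple q m g k :
  level_trace m g (Ind q (simple_class k)) =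
  if (val q * val (tag k))%N == m then
    \tr (ind_repr (dih_emb_inj (dvdn_ind_index q (tag k))) (irr_repr (tagged k))
      (g (val q * val (tag k))%N)) else 0.
Proof. by rewrite Ind_simple level_trace_class. Qed.

Lemma level_trace_rot_Ind q m a x :
  level_trace m (rotation a) (Ind q x) =
  if (val q %| m)%N && (val q %| a)%N then
    (val q)%:R * level_trace (m %/ val q) (rotation (a %/ val q)) x else 0.
Proof.
have q_gt0 : (0 < val q)%N by rewrite prime_gt0 // (valP q).
pose c : C := if (val q %| m)%N && (val q %| a)%N then (val q)%:R else 0.
transitivity (c * level_trace (m %/ val q) (rotation (a %/ val q)) x);
  last by rewrite /c; case: ifP; rewrite ?mul0r.
apply: (linear_malg_ext (f := level_trace m (rotation a) \o Ind q)
  (g := c \*: level_trace (m %/ val q) (rotation (a %/ val q)))) => k _ /=.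
rewrite -[<< k >>]/(simple_class k) level_trace_Ind_simple level_traceU.
rewrite /rotation mxtrace_ind_rot ind_index_div.
rewrite /c; have [<-|ne] := eqVneq (val q * val (tag k))%N m.
  rewrite dvdn_mulr //= mulKn // eqxx.
  by case: ifP => _ //; rewrite scale0r.
case: ifP => [/andP[/dvdnP[l e] _]|]; last by rewrite scale0r.
rewrite e mulnK // ifF ?scaler0 //; apply: contra_neqF ne => /eqP ->.
by rewrite e mulnC.
Qed.

Lemma level_trace_refl_Ind q m x : odd (val q) ->
  level_trace m reflection (Ind q x) =
  if (val q %| m)%N then level_trace (m %/ val q) reflection x else 0.
Proof.
move=> odd_q; have q_gt0 : (0 < val q)%N by rewrite prime_gt0 // (valP q).
pose c : C := (val q %| m)%N%:R.
transitivity (c * level_trace (m %/ val q) reflection x); last first.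
  by rewrite /c; case: ifP; rewrite ?mul0r ?mul1r.
apply: (linear_malg_ext (f := level_trace m reflection \o Ind q)
  (g := c \*: level_trace (m %/ val q) reflection)) => k _ /=.
rewrite -[<< k >>]/(simple_class k) level_trace_Ind_simple level_traceU.
rewrite /reflection mxtrace_ind_refl ?ind_index_div // /c.
have [<-|ne] := eqVneq (val q * val (tag k))%N m.
  by rewrite dvdn_mulr //= mulKn // eqxx scale1r.
case: (boolP (_ %| _)%N) => [/dvdnP[l e]|]; last by rewrite scale0r.
rewrite e mulnK // ifF ?scaler0 //; apply: contra_neqF ne => /eqP ->.
by rewrite e mulnC.
Qed.

(** Eliminates the dependent match in the definition of restriction. *)
Lemma res_simple_cases q k :
  (exists h : res_ok q (tag k), Res q (simple_class k) =
     module_class (n := res_index h)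
       (res_repr (dih_emb (dvdn_res_index h)) (irr_repr (tagged k)))) \/
  (~~ res_ok q (tag k) /\ Res q (simple_class k) = 0).
Proof.
have reflect_cases (Q : Prop) b (r : reflect Q b) (A : Type) (F : Q -> A) z :
    (exists h, (if r is ReflectT h then F h else z) = F h) \/
    (~ Q /\ (if r is ReflectT h then F h else z) = z).
  by case: r => [h|nh]; [left; exists h|right].
rewrite Res_simple /res_simple.
pose F (h : res_ok q (tag k)) := module_class (n := res_index h)
  (res_repr (dih_emb (dvdn_res_index h)) (irr_repr (tagged k))).
case: (reflect_cases _ _ (@idP (res_ok q (tag k))) _ F 0) => [[h ->]|[nh ->]].
  by left; exists h.
by right; split=> //; apply/negP.
Qed.

(** Stated for a pair of families g, g' that match under the embeddings, which
    covers reflections as well as rotations. *)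
Lemma level_trace_Res q m (g g' : forall m, dihedral m) x :
  (forall (n : dih_index) (h : res_ok q n),
    dih_emb (dvdn_res_index h) (g (val (res_index h))) = g' (val n)) ->
  level_trace m g (Res q x) =
  if (2 < m)%N then level_trace (val q * m)%N g' x else 0.
Proof.
move=> gg'; have q_gt0 : (0 < val q)%N by rewrite prime_gt0 // (valP q).
pose c : C := (2 < m)%N%:R.
transitivity (c * level_trace (val q * m)%N g' x); last first.
  by rewrite /c; case: ifP; rewrite ?mul0r ?mul1r.
apply: (linear_malg_ext (f := level_trace m g \o Res q)
  (g := c \*: level_trace (val q * m)%N g')) => k _ /=.
rewrite -[<< k >>]/(simple_class k) level_traceU /c.
case: (res_simple_cases q k) => [[h ->]|[nh ->]].
  rewrite level_trace_class mxtrace_res gg' /=; case/andP: (h) => q_dvd k_gt2.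
  have <- : (val (tag k) %/ val q == m)%N = (val (tag k) == val q * m)%N.
    by rewrite -(eqn_pmul2l q_gt0) [(val q * (_ %/ _))%N]mulnC divnK.
  by case: eqP => [<-|_]; rewrite ?scaler0 // k_gt2 scale1r.
rewrite linear0; case: eqP => [e|_]; last by rewrite scaler0.
have [m_gt2|] := boolP (2 < m)%N; last by rewrite scale0r.
by case/negP: nh; rewrite /res_ok e dvdn_mulr // mulKn.
Qed.

Lemma res_index_div q n (h : res_ok q n) :
  (val n %/ val (res_index h) = val q)%N.
Proof.
have n_gt0 : (0 < val n)%N by rewrite ltnW // ltnW // (valP n).
by case/andP: (h) => qn _; rewrite /= divnA // mulKn.
Qed.

Lemma level_trace_rot_Res q m a x :
  level_trace m (rotation a) (Res q x) =
  if (2 < m)%N then level_trace (val q * m)%N (rotation (val q * a)) x else 0.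
Proof.
apply: level_trace_Res => n h.
by rewrite /rotation morphX ?inE // dih_emb_r res_index_div expgM.
Qed.

Lemma level_trace_refl_Res q m x :
  level_trace m reflection (Res q x) =
  if (2 < m)%N then level_trace (val q * m)%N reflection x else 0.
Proof. by apply: level_trace_Res => n h; rewrite /reflection dih_emb_s. Qed.

Lemma level_trace_small n g x : (n < 3)%N -> level_trace n g x = 0.
Proof.
move=> n_lt3; rewrite /level_trace /lin_ext big1 // => k _.
rewrite ifF ?scaler0 //; apply: contraTF n_lt3 => /eqP <-.
by rewrite -leqNgt; apply: (valP (tag k)).
Qed.

(** The trace of an element A of the group algebra of level n.  The function
    tagged_as casts a simple module of level n to the index i; the simple
    modules of other levels are multiplied by 0. *)
Definition gring_trace (n : dih_index) (i : dih_irr C (val n))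
    (A : 'M[C]_(gcard [set: dihedral (val n)]%G)) : groth C -> C^o :=
  lin_ext (V := C^o) (fun k : simples C => (tag k == n)%:R *
    \tr (gring_op (irr_repr (tagged_as (simple_mod i) k)) A)).

HB.instance Definition _ n i A :=
  GRing.Linear.copy (@gring_trace n i A) (lin_ext _).

Lemma gring_traceU n (i : dih_irr C (val n)) A k :
  gring_trace i A << k >> = (tag k == n)%:R *
    \tr (gring_op (irr_repr (tagged_as (simple_mod i) k)) A).
Proof. by rewrite /gring_trace lin_extU scale1r. Qed.

(** The traces on rotations and on one reflection determine all traces when n
    is odd, and the irreducible characters are separated by the central
    idempotents e_i of the group algebra. *)
Lemma level_trace_inj x :
  (forall k, k \in msupp x -> odd (val (tag k))) ->
  (forall n a, level_trace n (rotation a) x = 0) ->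
  (forall n, level_trace n reflection x = 0) -> x = 0.
Proof.
move=> odd_x rot0 refl0; apply/malgP => -[n i]; rewrite mcoeff0.
pose G := [set: dihedral (val n)]%G.
have TG (y : dihedral (val n)) :
    gring_trace (i : dih_irr C (val n)) (regular_repr C G y) x = 0.
  case: y => a e.
  pose g m := if e then reflection m else rotation a m.
  rewrite -[RHS](_ : level_trace (val n) g x = 0); last first.
    by rewrite /g; case: (e).
  apply: linear_malg_ext => -[m j] /odd_x /= odd_m.
  rewrite gring_traceU -[<< _ >>]/(simple_class _) level_traceU /=.
  rewrite val_eqE; have [em|_] := eqVneq m n; last by rewrite mul0r.
  subst m; rewrite mul1r tagged_asE gring_opG ?inE //.
  rewrite /g; case: (e); last first.
    by rewrite /rotation dih_rX natr_Zp.
  have m_gt1 : (1 < val n)%N by apply: ltnW (valP n).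
  by have [t <-] := dih_reflection_conj a odd_m m_gt1; rewrite mxtrace_conjg.
have Tsum (u : dihedral (val n) -> C) :
    gring_trace (i : dih_irr C (val n))
      (\sum_(y in G) u y *: regular_repr C G y) x = 0.
  transitivity (\sum_(y in G) u y *
      gring_trace (i : dih_irr C (val n)) (regular_repr C G y) x).
    rewrite /gring_trace /lin_ext.
    under [RHS]eq_bigr do rewrite mulr_sumr.
    rewrite exchange_big /=; apply: eq_bigr => k _.
    rewrite !linear_sum /= mulr_sumr scaler_sumr; apply: eq_bigr => y _.
    set b := (_ == _)%:R; set rho := irr_repr _.
    have -> : \tr (gring_op rho (u y *: regular_mx C G y)) =
        u y * \tr (gring_op rho (regular_mx C G y)) by rewrite 2!linearZ.
    set t := \tr _.
    by rewrite -[LHS]/(x@_k * (b * (u y * t))) (mulrCA b); apply: mulrCA.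
  by apply: big1 => y _; rewrite TG mulr0.
have pG := dih_pgroup (val n).
have /envelop_mxP[u e_i] :
    (Wedderburn_id (i : dih_irr C (val n)) \in group_ring C G)%MS.
  rewrite -(Wedderburn_sum_pchar (dih_irr C (val n)) pG).
  by rewrite (sumsmx_sup (i : dih_irr C (val n))) // Wedderburn_id_mem.
have eU k : gring_trace i (Wedderburn_id (i : dih_irr C (val n))) << k >> =
    (k == simple_mod (i : dih_irr C (val n)))%:R *
    (irr_degree (i : dih_irr C (val n)))%:R.
  rewrite gring_traceU; case: k => m j /=.
  have [em|ne] := eqVneq m n; last first.
    by rewrite (negbTE (_ : _ != _)) ?mul0r //; apply: contra_neq ne => -[].
  subst m; rewrite tagged_asE mul1r eq_Tagged /=.
  have [->|ne] := eqVneq j i.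
    by rewrite op_Wedderburn_id_pchar // mxtrace1 mul1r.
  rewrite (irr_repr'_op0_pchar (j := i) pG) ?linear0 ?mul0r // 1?eq_sym //.
  exact: Wedderburn_id_mem.
have := Tsum u; rewrite -e_i linear_malgE => sum0.
apply/eqP/negPn/negP; rewrite mcoeff_neq0 => i_x.
move: sum0.
rewrite (bigD1_seq _ i_x) ?fset_uniq //= big1 => [|k ne]; last first.
  by rewrite eU (negbTE ne) mul0r scaler0.
rewrite addr0 eU eqxx mul1r => /eqP; rewrite scaler_eq0.
rewrite Num.Theory.pnatr_eq0 -[(_ == 0)%N]negbK -lt0n irr_degree_gt0 orbF.
by rewrite mcoeff_eq0 i_x.
Qed.

End TraceFunctionals.

(** * Trace coordinates *)

Section Coordinates.
Variable C : numClosedFieldType.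
Implicit Types (x : groth C) (b : bool).

(** The two families of traces put in a common form: b = true selects the
    rotations, b = false the reflections.  The latter are placed at a = 0,
    where the condition q | a in the formula for induction is void. *)
Definition coord b (n a : nat) (x : groth C) : C^o :=
  if b then level_trace n (rotation a) x
  else (a == 0)%:R *: level_trace n reflection x.

Lemma coord_is_linear b n a : linear (coord b n a).
Proof.
move=> c x y; rewrite /coord; case: b; first by rewrite linearP.
by rewrite linearP scalerDr !scalerA mulrC.
Qed.

HB.instance Definition _ b n a :=
  GRing.isLinear.Build C (groth C) C^o _ (coord b n a) (coord_is_linear b n a).

Definition ind_factor b (q : nat) : C := if b then q%:R else 1.

Lemma coord_Ind b q n a x : odd (val q) ->
  coord b n a (Ind q x) =
  if (val q %| n)%N && (val q %| a)%N
  then ind_factor b (val q) * coord b (n %/ val q) (a %/ val q) x else 0.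
Proof.
move=> odd_q; rewrite /coord /ind_factor; case: b.
  exact: level_trace_rot_Ind.
rewrite level_trace_refl_Ind //.
case: (val q %| n)%N => /=; last by rewrite scaler0.
case: (boolP (val q %| a)%N) => [/dvdnP[c ->]|].
  rewrite mulnK ?prime_gt0 ?(valP q) // mul1r muln_eq0.
  by rewrite [val q == 0]eqn0Ngt prime_gt0 ?(valP q) // orbF.
by case: eqP => [->|_ _]; rewrite ?dvdn0 // scale0r.
Qed.

Lemma coord_Res b q n a x :
  coord b n a (Res q x) =
  if (2 < n)%N then coord b (val q * n) (val q * a) x else 0.
Proof.
rewrite /coord; case: b; first exact: level_trace_rot_Res.
rewrite level_trace_refl_Res muln_eq0.
rewrite [val q == 0]eqn0Ngt prime_gt0 ?(valP q) //=.
by case: ifP => _; rewrite ?scaler0.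
Qed.

Lemma coord_small b n a x : (n < 3)%N -> coord b n a x = 0.
Proof.
by move=> n3; rewrite /coord; case: b; rewrite level_trace_small // scaler0.
Qed.

Lemma coord_inj x : (forall k, k \in msupp x -> odd (val (tag k))) ->
  (forall b n a, coord b n a x = 0) -> x = 0.
Proof.
move=> odd_x x0; apply: level_trace_inj => // [n a|n].
  exact: (x0 true).
by have := x0 false n 0; rewrite /coord scale1r.
Qed.

Lemma coord_level b n a x : coord b n a x != 0 ->
  n \in [seq val (tag k) | k <- msupp x].
Proof.
apply: contraNT => /mapP n_notin.
have lt0 g : level_trace n g x = 0.
  rewrite /level_trace /lin_ext big_seq big1 // => k kx.
  by case: eqP => [nk|_]; rewrite ?scaler0 //; case: n_notin; exists k.
by rewrite /coord; case: b; rewrite lt0 ?scaler0.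
Qed.

End Coordinates.

(** * Words in Res and Ind as shifts *)

Section Shifts.
Variable C : numClosedFieldType.
Implicit Types (y : nat -> nat -> C) (m n a : nat).

Definition shift m y n a : C :=
  if (m %| n)%N && (m %| a)%N then y (n %/ m)%N (a %/ m)%N else 0.

Lemma shift1 y n a : shift 1 y n a = y n a.
Proof. by rewrite /shift !dvd1n !divn1. Qed.

Lemma shift_shift m m' y n a : (0 < m)%N ->
  shift m (shift m' y) n a = shift (m * m') y n a.
Proof.
move=> m_gt0; rewrite /shift.
have dvdM u : (m * m' %| u)%N = (m %| u)%N && (m' %| u %/ m)%N.
  apply/idP/andP => [mm'|[/divnK <-]]; last first.
    by rewrite [(m * m')%N]mulnC dvdn_pmul2r // mulnK.
  have mu : (m %| u)%N by apply: dvdn_trans mm'; apply: dvdn_mulr.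
  by split=> //; rewrite dvdn_divRL // mulnC.
rewrite !dvdM -!divnMA.
by case: (m %| n)%N; case: (m %| a)%N; rewrite //= andbF.
Qed.

Lemma shiftMM q m y n a : (0 < q)%N ->
  shift (q * m) y (q * n) (q * a) = shift m y n a.
Proof. by move=> q_gt0; rewrite /shift !dvdn_pmul2l // !divnMl. Qed.

Lemma shiftZ (c : C) m y n a :
  shift m (fun n a => c * y n a) n a = c * shift m y n a.
Proof. by rewrite /shift; case: ifP; rewrite ?mulr0. Qed.

Lemma eq_shift m y y' : (forall n a, y n a = y' n a) ->
  forall n a, shift m y n a = shift m y' n a.
Proof. by move=> e n a; rewrite /shift; case: ifP. Qed.

End Shifts.

Section Words.
Variables (C : numClosedFieldType) (P : set prime_nat).
Hypothesis P_odd : forall p, P p -> odd (val p).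
Implicit Types (s : seq P) (w : seq (letter P)) (b : bool).

Definition letter_num (l : letter P) : nat :=
  if l is IndL q then val (val q) else 1.
Definition letter_den (l : letter P) : nat :=
  if l is ResL q then val (val q) else 1.
Definition word_num w := (\prod_(l <- w) letter_num l)%N.
Definition word_den w := (\prod_(l <- w) letter_den l)%N.
Definition word_factor b w : C :=
  \prod_(l <- w) (if l is IndL q then ind_factor C b (val (val q)) else 1).

Lemma prime_nat_gt0 (q : prime_nat) : (0 < val q)%N.
Proof. by rewrite prime_gt0 // (valP q). Qed.

Lemma word_num_gt0 w : (0 < word_num w)%N.
Proof.
rewrite /word_num; apply: prodn_gt0 => -[q|q] //=.
exact: prime_nat_gt0.
Qed.

Lemma word_den_gt0 w : (0 < word_den w)%N.
Proof.
rewrite /word_den; apply: prodn_gt0 => -[q|q] //=.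
exact: prime_nat_gt0.
Qed.

Lemma ind_factor_neq0 b (q : prime_nat) : ind_factor C b (val q) != 0.
Proof.
rewrite /ind_factor; case: b; rewrite ?oner_neq0 //.
by rewrite Num.Theory.pnatr_eq0 -lt0n prime_nat_gt0.
Qed.

Lemma word_factor_neq0 b w : word_factor b w != 0.
Proof.
rewrite /word_factor; elim/big_rec: _ => [|[q|q] c _ c0]; rewrite ?oner_neq0 //.
  by rewrite mul1r.
by rewrite mulf_neq0 // ind_factor_neq0.
Qed.

Definition word_seq_op w (x : groth C) : groth C := foldr (@letter_op C P) x w.

(** On a vector whose coordinates are shifted far enough, a word acts as a
    plain shift: every restriction in it undoes part of the available shift and
    never meets the bottom level 3. *)
Lemma coord_word b w k c (v u : groth C) :
  (forall n a, coord b n a u =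
    c * shift (k * word_den w) (fun n a => coord b n a v) n a) ->
  forall n a, coord b n a (word_seq_op w u) =
    word_factor b w * c *
    shift (k * word_num w) (fun n a => coord b n a v) n a.
Proof.
elim: w k => [|l w IHw] k uE n a.
  by rewrite uE /word_factor /word_num /word_den !big_nil mul1r.
have {}IHw := IHw (k * letter_den l)%N _.
move: uE; rewrite /word_factor /word_num /word_den !big_cons mulnA.
rewrite -/(word_factor b w) -/(word_num w) -/(word_den w) => /IHw{IHw} uE.
case: l uE => q /= uE.
  rewrite coord_Res uE mul1r mul1n mulnAC [(_ * val (val q))%N]mulnC.
  rewrite shiftMM ?prime_nat_gt0 //.
  case: ifP => // /negbT; rewrite -leqNgt => n3.
  rewrite /shift; case: ifP => _; rewrite ?mulr0 // coord_small ?mulr0 //.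
  by apply: leq_ltn_trans (leq_div _ _) _.
rewrite coord_Ind; last by apply: P_odd; apply: set_mem (valP q).
transitivity (ind_factor C b (val (val q)) *
    shift (val (val q)) (fun n a => coord b n a (word_seq_op w u)) n a).
  by rewrite /shift; case: ifP; rewrite ?mulr0.
rewrite (@eq_shift C _ _ (fun n a => word_factor b w * c *
  shift (k * letter_den (IndL q) * word_num w)
    (fun n a => coord b n a v) n a) uE).
rewrite shiftZ shift_shift ?prime_nat_gt0 // !mulrA /= muln1.
by rewrite mulnCA.
Qed.

Definition ind_word (s : seq P) : seq (letter P) := map (@IndL P) s.

Lemma word_den_ind (s : seq P) : word_den (ind_word s) = 1%N.
Proof. by rewrite /word_den big_map big1. Qed.

Lemma coord_ind_word b s x n a :
  coord b n a (word_seq_op (ind_word s) x) =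
  word_factor b (ind_word s) *
  shift (word_num (ind_word s)) (fun n a => coord b n a x) n a.
Proof.
rewrite (@coord_word b _ 1 1 x x) ?mulr1 ?mul1n // => m c.
by rewrite word_den_ind shift1 mul1r.
Qed.

Lemma word_num_cat w w' : word_num (w ++ w') = (word_num w * word_num w')%N.
Proof. exact: big_cat. Qed.

(** It suffices to induce along all primes of all restrictions in the words. *)
Lemma ind_word_multiple (ws : seq {fmonom letter P}) :
  exists s : seq P, forall v : {fmonom letter P}, v \in ws ->
    (word_den (fmonom_val v) %| word_num (ind_word s))%N.
Proof.
elim: ws => [|w ws [s sP]]; first by exists [::].
pose res l := if l is ResL q then [:: q] else [::] : seq P.
have resE (v : seq (letter P)) :
    word_den v = word_num (ind_word (flatten (map res v))).
  elim: v => [|l v IHv] /=; first by rewrite /word_den /word_num !big_nil.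
  rewrite /ind_word map_cat word_num_cat -/(ind_word _) -IHv /word_den big_cons.
  by case: l => q /=; rewrite /word_num ?big_seq1 // big_nil.
exists (flatten (map res (fmonom_val w)) ++ s) => v.
rewrite /ind_word map_cat word_num_cat -!/(ind_word _) -resE.
by rewrite inE => /predU1P[->|/sP vs]; [apply: dvdn_mulr|apply: dvdn_mull].
Qed.

Lemma actE (a : freeA C P) x :
  act a x = \sum_(w <- msupp (a : free_ring C P))
    (a : free_ring C P)@_w *: word_seq_op (fmonom_val w) x.
Proof. by []. Qed.

(** These operators multiply as the semigroup algebra of the positive integers
    under multiplication. *)
Definition shift_sum (d : {malg C[nat]}) (y : nat -> nat -> C) n a : C :=
  \sum_(m <- msupp d) d@_m * shift m y n a.

(** After the inductions of s every word of a is a pure shift, and neither s nor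
    the coefficients d depend on the vector. *)
Lemma act_shift_sum b (a : freeA C P) : exists (s : seq P) (d : {malg C[nat]}),
  (forall m, m \in msupp d -> (0 < m)%N) /\
  forall x n c, coord b n c (act a (word_seq_op (ind_word s) x)) =
    shift_sum d (fun n c => coord b n c x) n c.
Proof.
have [s sP] := ind_word_multiple (msupp (a : free_ring C P)).
pose t := word_num (ind_word s).
pose g (w : {fmonom letter P}) :=
  (t %/ word_den (fmonom_val w) * word_num (fmonom_val w))%N.
pose e (w : {fmonom letter P}) : C :=
  word_factor b (fmonom_val w) * word_factor b (ind_word s).
pose d : {malg C[nat]} := \sum_(w <- msupp (a : free_ring C P))
  << (a : free_ring C P)@_w * e w *g g w >>.
exists s, d; split=> [m|x n c].
  rewrite -mcoeff_neq0; case: (posnP m) => // ->; apply: contraNT => _.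
  rewrite /d raddf_sum big_seq big1 //= => w wa; rewrite mcoeffU.
  suff /negbTE -> : g w != 0%N by [].
  by rewrite -lt0n /g muln_gt0 word_num_gt0 andbT divn_gt0 ?word_den_gt0 //
    dvdn_leq ?word_num_gt0 // sP.
rewrite actE linear_sum /=.
transitivity (\sum_(w <- msupp (a : free_ring C P))
  (a : free_ring C P)@_w * e w * shift (g w) (fun n c => coord b n c x) n c).
  rewrite !big_seq; apply: eq_bigr => w wa; rewrite linearZ /= -mulrA.
  congr (_ * _).
  rewrite (@coord_word b _ (t %/ word_den (fmonom_val w))
    (word_factor b (ind_word s)) x) //.
  by move=> n' c'; rewrite divnK ?sP // coord_ind_word.
rewrite -[RHS]/(lin_ext (V := C^o)
  (fun m => shift m (fun n c => coord b n c x) n c) d).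
by rewrite linear_sum; apply: eq_bigr => w _ /=; rewrite lin_extU.
Qed.

End Words.

(** * Idempotents among combinations of shifts *)

Section ShiftAlgebra.
Variable C : numClosedFieldType.
Implicit Types (y : nat -> nat -> C) (d : {malg C[nat]}) (up : bool).

(** Both orders on nat at once: highest and lowest levels are treated alike. *)
Definition ledir up (m n : nat) := if up then (m <= n)%N else (n <= m)%N.

Lemma ledir_antisym up m n : ledir up m n -> ledir up n m -> m = n.
Proof. by case: up => /= h1 h2; apply/eqP; rewrite eqn_leq h1 h2. Qed.

Lemma ledir_mul up m m' n n' :
  ledir up m m' -> ledir up n n' -> ledir up (m * n) (m' * n').
Proof. by case: up; apply: leq_mul. Qed.

Lemma ledir_mul_eq up m m' n n' : (0 < m')%N -> (0 < n')%N ->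
  ledir up m m' -> ledir up n n' -> (m * n = m' * n')%N -> m = m'.
Proof.
move=> m'_gt0 n'_gt0; case: up => /= le_m le_n e; apply/eqP.
  rewrite eqn_leq le_m /= -(leq_pmul2r n'_gt0) -e leq_mul2l le_n orbT //.
rewrite eqn_leq le_m andbT -(leq_pmul2r n'_gt0) -e leq_mul2l le_n orbT //.
Qed.

Lemma ledir_extreme up (L : seq nat) (Q : pred nat) : has Q L ->
  exists N, [/\ N \in L, Q N & forall n, n \in L -> Q n -> ledir up n N].
Proof.
elim: L => //= n L IHL.
case QL : (has Q L); last first.
  rewrite orbF => Qn; exists n; split; rewrite ?mem_head // => k.
  rewrite inE => /predU1P[->|kL Qk]; first by case: (up) => /=.
  by case/negP: (negbT QL); apply/hasP; exists k.
move=> _; have [N [NL QN maxN]] := IHL QL.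
case Qn : (Q n); last first.
  exists N; split; rewrite ?inE ?NL ?orbT // => k /predU1P[->|];
    last exact: maxN.
  by rewrite Qn.
have [nN|Nn] : ledir up n N \/ ledir up N n.
  by case: (up) => /=; apply/orP; rewrite leq_total.
  exists N; split; rewrite ?inE ?NL ?orbT // => k /predU1P[->|] //.
  exact: maxN.
exists n; split; rewrite ?mem_head // => k; rewrite inE => /predU1P[->|kL Qk].
  by case: (up) => /=.
move: (maxN k kL Qk) Nn; case: (up) => /= h1 h2; first exact: leq_trans h2.
exact: leq_trans h1.
Qed.

Lemma eq_shift_sum d y y' : (forall n c, y n c = y' n c) ->
  forall n c, shift_sum d y n c = shift_sum d y' n c.
Proof.
by move=> e n c; apply: eq_bigr => m _; congr (_ * _); apply: eq_shift.
Qed.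

Definition extreme up y N :=
  (exists c, y N c != 0) /\ (forall n c, y n c != 0 -> ledir up n N).

Lemma extreme_uniq up y N N' : extreme up y N -> extreme up y N' -> N = N'.
Proof.
by move=> [[c yN] maxN] [[c' yN'] maxN']; apply: (@ledir_antisym up); eauto.
Qed.

Lemma eq_extreme up y y' N : (forall n c, y n c = y' n c) ->
  extreme up y N -> extreme up y' N.
Proof.
move=> e [[c yN] maxN]; split=> [|n c']; first by exists c; rewrite -e.
by rewrite -e; apply: maxN.
Qed.

Lemma shift_neq0 m y n c : shift m y n c != 0 ->
  exists n' c', [/\ n = (m * n')%N, c = (m * c')%N & y n' c' != 0].
Proof.
rewrite /shift; case: ifP => [/andP[mn mc] yn|_]; last by rewrite eqxx.
by exists (n %/ m)%N, (c %/ m)%N; rewrite ![(m * _)%N]mulnC !divnK.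
Qed.

Lemma shift_sum_neq0 d y n c : shift_sum d y n c != 0 ->
  exists m n' c', [/\ m \in msupp d, n = (m * n')%N & y n' c' != 0].
Proof.
rewrite /shift_sum => sum0.
have [/hasP[m md /shift_neq0[n' [c' [nE _ yn]]]]|/hasPn all0] :=
    boolP (has (fun m => shift m y n c != 0) (msupp d)).
  by exists m, n', c'.
case/eqP: sum0; rewrite big_seq big1 // => m /all0 /negPn/eqP ->.
by rewrite mulr0.
Qed.

Lemma shift_sum0 d y c :
  (forall c, y 0%N c = 0) -> (forall m, m \in msupp d -> (0 < m)%N) ->
  shift_sum d y 0 c = 0.
Proof.
move=> y0 d_gt0; apply/eqP; apply: contraT => /shift_sum_neq0.
case=> m [n [c' [/d_gt0 m_gt0 /esym/eqP]]].
by rewrite muln_eq0 eqn0Ngt m_gt0 => /eqP ->; rewrite y0 eqxx.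
Qed.

(** Extreme levels multiply, as leading terms of polynomials do. *)
Lemma extreme_shift_sum up d y m1 N :
  (forall m, m \in msupp d -> (0 < m)%N) -> (forall c, y 0%N c = 0) ->
  m1 \in msupp d -> (forall m, m \in msupp d -> ledir up m m1) ->
  extreme up y N -> extreme up (shift_sum d y) (m1 * N).
Proof.
move=> d_gt0 y0 m1d maxm1 [[c yN] maxN]; split; last first.
  move=> n c' /shift_sum_neq0[m [n' [c'' [md -> yn]]]].
  by apply: ledir_mul; [apply: maxm1|apply: maxN yn].
have N_gt0 : (0 < N)%N by case: (posnP N) yN => // ->; rewrite y0 eqxx.
exists (m1 * c)%N; rewrite /shift_sum (bigD1_seq m1) ?fset_uniq //=.
rewrite -[X in shift X y]muln1 shiftMM ?d_gt0 // shift1.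
rewrite big_seq_cond big1 ?addr0 ?mulf_neq0 ?mcoeff_neq0 // => m /andP[md ne].
have [->|/shift_neq0[n' [c' [e _ yn]]]] :=
    eqVneq (shift m y (m1 * N) (m1 * c)) 0.
  by rewrite mulr0.
case/eqP: ne; apply: (@ledir_mul_eq up m m1 n' N) => //.
- exact: d_gt0.
- exact: maxm1.
- exact: maxN yn.
Qed.

Lemma shift_sumU (k : C) t y n c :
  shift_sum << k *g t >> y n c = k * shift t y n c.
Proof. exact: (lin_extU (V := C^o) (fun m => shift m y n c)). Qed.

(** Extreme levels of a nonzero y give m1 * m1 * N = m1 * t * N for the largest
    and for the smallest index m1 of d, so d is supported at t; the coefficient
    is then found from c * c = c * k. *)
Lemma shift_sum_idempotent d y (L : seq nat) (k : C) t :
  (forall m, m \in msupp d -> (0 < m)%N) -> (0 < t)%N -> k != 0 ->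
  (forall c, y 0%N c = 0) -> (forall n c, y n c != 0 -> n \in L) ->
  (exists n c, y n c != 0) ->
  (forall n c, shift_sum d (shift_sum d y) n c =
               shift_sum d (shift_sum << k *g t >> y) n c) ->
  d = 0 \/ d = << k *g t >>.
Proof.
move=> d_gt0 t_gt0 k0 y0 yL [n0 [c0 y_neq0]] dd.
have [->|/negP d0] := eqVneq d 0; [by left|right].
have supp_t : msupp << k *g t >> = [fset t]%fset by rewrite msuppU (negbTE k0).
have all_t up m : m \in msupp d -> ledir up m t.
  have [|N [_ /asboolP exN maxN]] :=
      @ledir_extreme up L (fun n => `[< exists c, y n c != 0 >]).
    by apply/hasP; exists n0; [apply: yL y_neq0|apply/asboolP; exists c0].
  have extN : extreme up y N.
    by split=> // n c yn; apply: maxN; [apply: yL yn|apply/asboolP; exists c].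
  have [|m1 [m1d _ maxm1]] := @ledir_extreme up (msupp d) predT.
    rewrite has_predT lt0n; apply: contra_notN d0 => /nilP s0.
    apply/eqP/malgP => i; rewrite mcoeff0 mcoeff_outdom //.
    by rewrite -[_ \in _]/(i \in (msupp d : seq nat)) s0.
  have ext1 := extreme_shift_sum d_gt0 y0 m1d (fun m md => maxm1 m md isT) extN.
  have ext2 := extreme_shift_sum d_gt0 (fun c => shift_sum0 c y0 d_gt0) m1d
    (fun m md => maxm1 m md isT) ext1.
  have t_pos i : i \in msupp << k *g t >> -> (0 < i)%N.
    by rewrite supp_t inE => /eqP ->.
  have ext3 : extreme up (shift_sum << k *g t >> y) (t * N).
    apply: extreme_shift_sum => //; first by rewrite supp_t inE.
    by move=> i; rewrite supp_t inE => /eqP ->; case: (up) => /=.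
  have ext4 := extreme_shift_sum d_gt0 (fun c => shift_sum0 c y0 t_pos) m1d
    (fun m md => maxm1 m md isT) ext3.
  have := extreme_uniq (eq_extreme dd ext2) ext4.
  have m1_gt0 := d_gt0 _ m1d.
  have N_gt0 : (0 < N)%N.
    by case: (posnP N) exN => // -> [c]; rewrite y0 eqxx.
  move=> /eqP; rewrite eqn_pmul2l // eqn_pmul2r // => /eqP <- md.
  exact: maxm1.
have dE : d = << d@_t *g t >>.
  apply/malgP => m; rewrite mcoeffU; have [<-//|ne] := eqVneq t m.
  rewrite mulr0n mcoeff_outdom //; apply: contra ne => md; apply/eqP.
  by apply: (@ledir_antisym true); [apply: (all_t false)|apply: all_t].
rewrite dE; congr << _ *g _ >>.
(* The place to which both sides shift the nonzero coordinate (n0, c0) of y. *)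
have := dd (t * (t * n0))%N (t * (t * c0))%N.
rewrite dE !shift_sumU.
rewrite -[X in shift X]muln1 !shiftMM // !shift1 !shift_sumU.
rewrite -[X in shift X]muln1 !shiftMM // !shift1.
have dt0 : d@_t != 0.
  by apply: contra_notN d0 => /eqP dt; rewrite dE dt monalgU0.
by rewrite mcoeffUU => /(mulfI dt0)/(mulIf y_neq0).
Qed.

End ShiftAlgebra.

(** * Central idempotents on the two pieces *)

Lemma lspan_odd (C : numClosedFieldType) (N : set (groth C)) x :
  spanned_by_odd_simples N -> N x ->
  forall k, k \in msupp x -> odd (val (tag k)).
Proof.
case=> B [B_odd ->] [m [c [u [uB ->]]]] k.
rewrite -mcoeff_neq0 raddf_sum /= => sum_neq0.
have [i uik] : exists i, (u i)@_k != 0.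
  apply: contrapT => /forallNP u0; case/eqP: sum_neq0; apply: big1 => i _.
  by move/negP/negPn/eqP: (u0 i) => uik; rewrite mcoeffZ uik mulr0.
move: uik; have [k' Bk' <-] := uB i.
rewrite mcoeffU; case: (k' =P k) => [<- _|_]; first exact: B_odd.
by rewrite mulr0n eqxx.
Qed.

Section Pieces.
Variables (C : numClosedFieldType) (P : set prime_nat).
Hypothesis P_odd : forall p, P p -> odd (val p).
Variable M : submodule C P.
Hypothesis M_odd :
  forall x, M x -> forall k, k \in msupp x -> odd (val (tag k)).
Implicit Types (a c : freeA C P) (b : bool) (x : groth C).

Lemma actB a c x : act (a - c) x = act a x - act c x.
Proof. by rewrite /act raddfB. Qed.

Lemma act0 x : act (0 : freeA C P) x = 0.
Proof. by rewrite /act raddf0. Qed.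

Lemma submodule_act a x : M x -> M (act a x).
Proof. by case: (submoduleP M) => _ _; apply. Qed.

Lemma submodule_add x y : M x -> M y -> M (x + y).
Proof. by case: (submoduleP M) => _ + _; apply. Qed.

(** The part of M that is seen by the coordinates of kind b only; Res_q Ind_q is
    the scalar ind_factor b q on it. *)
Definition piece b x := M x /\ forall n i, coord (~~ b) n i x = 0.

Lemma piece_act b a x : piece b x -> piece b (act a x).
Proof.
case=> Mx x0; split=> [|n i]; first exact: submodule_act.
rewrite actE linear_sum big1 // => w _; rewrite linearZ /=.
(* With factor 0 the shift formula says that words preserve zero coordinates. *)
rewrite (@coord_word _ _ P_odd _ _ 0 0 x x) ?mulr0 ?mul0r ?scaler0 // => n' i'.
by rewrite x0 mul0r.
Qed.

Lemma piece_inj b x : piece b x -> (forall n i, coord b n i x = 0) -> x = 0.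
Proof.
case=> Mx x0 x1; apply: coord_inj; first exact: M_odd.
by move=> b' n i; have [->|] := eqVneq b' b; [|case: (b) (b') x0 => -[]].
Qed.

Lemma pieceB b x y : piece b x -> piece b y -> piece b (x - y).
Proof.
move=> [Mx x0] [My y0]; split=> [|n i]; last by rewrite linearB /= x0 y0 subrr.
apply: submodule_add => //; have := submodule_act (- 1) My.
by rewrite -[-1 : freeA C P]add0r actB Defs.act1 act0 add0r.
Qed.

Definition ind_elt (s : seq P) : freeA C P :=
  (<< FMonom (ind_word s) >> : free_ring C P).

Lemma act_ind_elt s x : act (ind_elt s) x = word_seq_op (ind_word s) x.
Proof. by rewrite /ind_elt act_monom scale1r. Qed.

Lemma ind_elt_inj b s x : piece b x ->
  (forall n i, coord b n i (act (ind_elt s) x) = 0) -> x = 0.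
Proof.
move=> Wx x0; apply: (piece_inj Wx) => n i.
have := x0 (word_num (ind_word s) * n)%N (word_num (ind_word s) * i)%N.
rewrite act_ind_elt coord_ind_word //.
rewrite -[X in shift X]muln1 shiftMM ?word_num_gt0 // shift1 => /eqP.
by rewrite mulf_eq0 (negbTE (word_factor_neq0 _ _ _)) => /eqP.
Qed.

(** The vector v serves to determine the coefficients d of a Ind_s; they are the
    same for all vectors of the piece, hence so is the conclusion. *)
Lemma central_idempotent_piece b a :
  (forall x, piece b x -> act a (act a x) = act a x) ->
  (forall c x, piece b x -> act a (act c x) = act c (act a x)) ->
  (forall x, piece b x -> act a x = 0) \/ (forall x, piece b x -> act a x = x).
Proof.
move=> a_idem a_central.
have [all0|/existsNP[v /not_implyP[Wv v_neq0]]] :=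
    EM (forall x, piece b x -> x = 0).
  by left=> x /(piece_act a)/all0.
have [s [d [d_gt0 dE]]] := act_shift_sum P_odd b a.
pose t := word_num (ind_word s); pose k := word_factor C b (ind_word s).
pose y n i : C := coord b n i v.
have dE' x n i : coord b n i (act a (act (ind_elt s) x)) =
    shift_sum d (fun n i => coord b n i x) n i.
  by rewrite act_ind_elt dE.
have sE x n i : coord b n i (act (ind_elt s) x) =
    shift_sum << k *g t >> (fun n i => coord b n i x) n i.
  by rewrite act_ind_elt coord_ind_word // shift_sumU.
have [d0|d1] : d = 0 \/ d = << k *g t >>.
  apply: (@shift_sum_idempotent C d y [seq val (tag k) | k <- msupp v]) => //.
  - exact: word_num_gt0.
  - exact: word_factor_neq0.
  - by move=> i; apply: coord_small.
  - by move=> n i; apply: coord_level.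
  - apply: contrapT => /forallNP y0; apply: v_neq0.
    apply: (piece_inj Wv) => n i.
    by move/forallNP/(_ i)/negP/negPn/eqP: (y0 n).
  move=> n i; pose u := act a (act (ind_elt s) v).
  have Wsv : piece b (act (ind_elt s) v) by apply: piece_act.
  transitivity (coord b n i (act a (act (ind_elt s) u))).
    by rewrite dE'; apply: eq_shift_sum => n' i'; rewrite dE'.
  rewrite -a_central // a_idem; last by apply: piece_act.
  by rewrite dE'; apply: eq_shift_sum => n' i'; rewrite sE.
- left=> x Wx; apply: (@ind_elt_inj b s); first exact: piece_act.
  move=> n i; rewrite -a_central // dE' d0 /shift_sum.
  by rewrite big1 // => m _; rewrite mcoeff0 mul0r.
- right=> x Wx; apply/eqP; rewrite -subr_eq0; apply/eqP.
  apply: (@ind_elt_inj b s).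
    by apply: pieceB => //; apply: piece_act.
  move=> n i; have -> : act (ind_elt s) (act a x - x) =
      act a (act (ind_elt s) x) - act (ind_elt s) x.
    by rewrite linearB a_central.
  rewrite linearB /=; apply/eqP; rewrite subr_eq0; apply/eqP.
  by apply: (etrans (dE' _ _ _)); rewrite d1; apply/esym/sE.
Qed.

End Pieces.

(** * Quotient algebras and indecomposability *)

Section Quotients.
Variables (C : comNzRingType) (A : algebra C) (I : ideal A).

Lemma quot_piD x y : quot_pi I (x + y) = quot_pi I x + quot_pi I y.
Proof. exact: to_quotD. Qed.

Lemma quot_piM x y : quot_pi I (x * y) = quot_pi I x * quot_pi I y.
Proof. exact: to_quotM. Qed.

Lemma quot_pi1 : quot_pi I 1 = 1. Proof. by []. Qed.

Lemma quot_piB x y : quot_pi I (x - y) = quot_pi I x - quot_pi I y.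
Proof. by apply/(canRL (addrK _)); rewrite -quot_piD subrK. Qed.

Lemma quot_pi0 : quot_pi I 0 = 0.
Proof. by rewrite -(subrr 0) quot_piB subrr. Qed.

Lemma quot_pi_nat n : quot_pi I n%:R = n%:R.
Proof.
by elim: n => [|n IHn]; rewrite ?quot_pi0 // mulrS quot_piD IHn -mulrS.
Qed.

Lemma quot_pi_eq0 x : quot_pi I x = 0 <-> I x.
Proof. by rewrite -quot_pi0 -[in X in _ <-> X](subr0 x); apply: to_quotP. Qed.

Lemma quot_pi_surj (z : alg_quot I) : exists x, z = quot_pi I x.
Proof. by exists (of_quot z); rewrite /quot_pi of_quotK. Qed.

End Quotients.

Section AlgebraFacts.
Variables (C : comNzRingType) (A : algebra C).

Lemma alg_scale_nat n (x : A) : alg_scale n%:R x = x *+ n.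
Proof.
elim: n => [|n IHn].
  by apply: (addrI (alg_scale 0 x)); rewrite -alg_scaleDl !addr0.
by rewrite !mulrS alg_scaleDl alg_scale1 IHn.
Qed.

Lemma alg_scale0 a : alg_scale a (0 : A) = 0.
Proof. by apply: (addrI (alg_scale a 0)); rewrite -alg_scaleDr !addr0. Qed.

(** A product decomposition singles out the central idempotent (1, 0). *)
Lemma indecomposable_central_idempotent :
  (forall e : A, e * e = e -> (forall x, e * x = x * e) -> e = 0 \/ e = 1) ->
  indecomposable A.
Proof.
move=> e_triv [B1 [B2 [f [_ f_bij]]]].
have f_inj := bij_inj f_bij; case: f_bij => g _ gK.
have [||e0|e1] := e_triv (g (1, 0)).
- by apply: f_inj; rewrite rmorphM gK; congr pair; rewrite ?mulr1 ?mulr0.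
- move=> x; apply: f_inj; rewrite !rmorphM gK; case: (f x) => u v.
  by congr pair; rewrite /= ?mul1r ?mulr1 ?mul0r ?mulr0.
- have := gK (1, 0); rewrite e0 rmorph0 => -[/esym/eqP].
  by rewrite oner_eq0.
- have := gK (1, 0); rewrite e1 rmorph1 => -[/eqP].
  by rewrite oner_eq0.
Qed.

End AlgebraFacts.

Lemma alg_mulrn_inj (F : fieldType) (B : algebra F) n m (x : B) :
  n%:R - m%:R != 0 :> F -> x *+ n = x *+ m -> x = 0.
Proof.
move=> nm0 e; rewrite -[LHS]alg_scale1 -(mulVf nm0) -alg_scaleA.
have -> : alg_scale (n%:R - m%:R) x = 0; last exact: alg_scale0.
apply: (addIr (alg_scale m%:R x)).
by rewrite -alg_scaleDl subrK !alg_scale_nat add0r.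
Qed.

(** * The quotient algebra acting on a piece *)

Section PieceQuotient.
Variables (C : numClosedFieldType) (P : set prime_nat).
Hypothesis P_odd : forall p, P p -> odd (val p).
Variable M : submodule C P.
Hypothesis M_odd :
  forall x, M x -> forall k, k \in msupp x -> odd (val (tag k)).
Variables (p : set_type P) (b : bool).
Implicit Types (a c : freeA C P) (x : groth C).

Definition nat_factor (b' : bool) : nat := if b' then val (val p) else 1.

Lemma ind_factorE b' : ind_factor C b' (val (val p)) = (nat_factor b')%:R.
Proof. by case: b'. Qed.

Definition res_ind : freeA C P := gen_res C p * gen_ind C p.

Lemma act_res_ind x : act res_ind x = Res (val p) (Ind (val p) x).
Proof. by rewrite /res_ind Defs.actM !act_monom !scale1r. Qed.

Lemma coord_res_ind b' n i x :
  coord b' n i (act res_ind x) = (nat_factor b')%:R * coord b' n i x.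
Proof.
rewrite act_res_ind coord_Res -ind_factorE.
case: ifP => [_|/negbT]; last first.
  by rewrite -leqNgt => n_lt3; rewrite coord_small ?mulr0.
rewrite coord_Ind; last by apply: P_odd; apply: set_mem (valP p).
by rewrite !dvdn_mulr //= !mulKn ?prime_nat_gt0.
Qed.

Lemma act_nat n x : act (n%:R : freeA C P) x = n%:R *: x.
Proof.
elim: n => [|n IHn]; first by rewrite act0 scale0r.
by rewrite !mulrS Defs.actD Defs.act1 IHn scalerDl scale1r.
Qed.

Lemma coord_res_ind_nat b' k n i x :
  coord b' n i (act (res_ind - k%:R : freeA C P) x) =
  ((nat_factor b')%:R - k%:R) * coord b' n i x.
Proof.
rewrite actB linearB /= mulrBl; congr (_ - _); first exact: coord_res_ind.
by rewrite act_nat linearZ.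
Qed.

Definition relator : quotA M :=
  quot_res M p * quot_ind M p - (nat_factor b)%:R.

(** The projection from the free algebra onto the quotient, through A_{P,M}. *)
Definition to_quotient a : alg_quot (ideal_gen relator) :=
  quot_pi (ideal_gen relator) (quot_pi (Ann M) a).

Lemma to_quotientB a c : to_quotient (a - c) = to_quotient a - to_quotient c.
Proof. by rewrite /to_quotient !quot_piB. Qed.

Lemma to_quotientM a c : to_quotient (a * c) = to_quotient a * to_quotient c.
Proof. by rewrite /to_quotient !quot_piM. Qed.

Lemma relatorE : relator = quot_pi (Ann M) (res_ind - (nat_factor b)%:R).
Proof. by rewrite quot_piB quot_piM quot_pi_nat. Qed.

Lemma act_of_quot a x : M x -> act (of_quot (quot_pi (Ann M) a)) x = act a x.
Proof.
move=> Mx; apply/eqP; rewrite -subr_eq0 -actB; apply/eqP.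
exact: (@of_quot_congr _ _ (Ann M) a x Mx).
Qed.

Lemma piece_killer_subproof : two_sided_ideal
  [set z : quotA M | forall x, piece M b x -> act (of_quot z) x = 0]%classic.
Proof.
split=> [x [Mx _]|z z' Iz Iz' x Wx|z1 z z2 Iz x Wx] /=.
- by rewrite -(quot_pi0 (Ann M)) act_of_quot // act0.
- have [Mx _] := Wx; move: Iz Iz'.
  have [[a ->] [a' ->]] := (quot_pi_surj z, quot_pi_surj z') => Ia Ia'.
  rewrite -quot_piD act_of_quot // Defs.actD.
  by rewrite -(act_of_quot a Mx) Ia // -(act_of_quot a' Mx) Ia' // addr0.
have [Mx _] := Wx; move: Iz.
have [a ->] := quot_pi_surj z; have [a1 ->] := quot_pi_surj z1.
have [a2 ->] := quot_pi_surj z2 => Ia.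
have Wx2 : piece M b (act a2 x) by apply: piece_act.
have -> : quot_pi (Ann M) a1 * quot_pi (Ann M) a * quot_pi (Ann M) a2 =
    quot_pi (Ann M) (a1 * a * a2) by rewrite !quot_piM.
rewrite act_of_quot // !Defs.actM.
by rewrite -(act_of_quot a Wx2.1) Ia // linear0.
Qed.

Definition piece_killer : ideal (quotA M) := Ideal piece_killer_subproof.

(** The elements of A_{P,M} that annihilate the piece form an ideal that
    contains the relator. *)
Lemma to_quotient_eq0_act a :
  to_quotient a = 0 -> forall x, piece M b x -> act a x = 0.
Proof.
move/quot_pi_eq0 => /(_ piece_killer) Ka x Wx.
rewrite -(act_of_quot a Wx.1); apply: Ka Wx => {}x Wx.
have [Mx _] := Wx; rewrite relatorE act_of_quot //.
apply: (piece_inj M_odd (b := b)); first by apply: piece_act.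
by move=> n i; rewrite coord_res_ind_nat subrr mul0r.
Qed.

Lemma to_quotient_eq_act a c x :
  to_quotient a = to_quotient c -> piece M b x -> act a x = act c x.
Proof.
move=> ac Wx; apply/eqP; rewrite -subr_eq0 -actB; apply/eqP.
by apply: to_quotient_eq0_act Wx; rewrite to_quotientB ac subrr.
Qed.

(** With g = Res_p Ind_p - k', where k' is the value of Res_p Ind_p on the
    other piece, g maps M into the piece, so that a g annihilates M.
    In the quotient g is the nonzero number k - k', thus a vanishes there. *)
Lemma act_eq0_to_quotient a :
  (forall x, piece M b x -> act a x = 0) -> to_quotient a = 0.
Proof.
move=> a0; pose g := res_ind - (nat_factor (~~ b))%:R : freeA C P.
have Ann_ag : Ann M (a * g).
  move=> x Mx; rewrite Defs.actM; apply: a0; split; first exact: submodule_act.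
  by move=> n i; rewrite coord_res_ind_nat subrr mul0r.
have r0 : quot_pi (ideal_gen relator) relator = 0.
  by apply/quot_pi_eq0 => I.
have : to_quotient (a * g) = 0.
  by rewrite /to_quotient; move/quot_pi_eq0: Ann_ag => ->; rewrite quot_pi0.
rewrite /to_quotient quot_piM quot_piM -/(to_quotient a).
have -> : quot_pi (ideal_gen relator) (quot_pi (Ann M) g) =
    (nat_factor b)%:R - (nat_factor (~~ b))%:R.
  rewrite /g quot_piB quot_piB !quot_pi_nat; congr (_ - _).
  apply/eqP; rewrite -subr_eq0 -(quot_pi_nat (ideal_gen relator)) -quot_piB.
  by rewrite -(quot_pi_nat (Ann M)) -quot_piB -relatorE r0.
rewrite mulrBr !mulr_natr => /eqP; rewrite subr_eq0 => /eqP e.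
have k0 : (nat_factor b)%:R - (nat_factor (~~ b))%:R != 0 :> C.
  have p_neq1 : (val (val p))%:R != 1 :> C.
    rewrite -[1]/(1%:R) Num.Theory.eqr_nat neq_ltn orbC.
    by rewrite prime_gt1 // (valP (val p)).
  by rewrite /nat_factor; case: (b); rewrite subr_eq0 //= eq_sym.
exact: alg_mulrn_inj k0 e.
Qed.

Lemma piece_quotient_indecomposable :
  indecomposable (alg_quot (ideal_gen relator)).
Proof.
apply: indecomposable_central_idempotent => e e_idem e_central.
have to_quotient_surj z : exists a, z = to_quotient a.
  have [z' ->] := quot_pi_surj z; have [a ->] := quot_pi_surj z'.
  by exists a.
have [a ea] := to_quotient_surj e.
have [||a0|a1] := central_idempotent_piece P_odd M_odd (b := b) (a := a).
- move=> x; rewrite -Defs.actM; apply: to_quotient_eq_act.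
  by rewrite to_quotientM -ea.
- move=> c x; rewrite -!Defs.actM; apply: to_quotient_eq_act.
  transitivity (to_quotient a * to_quotient c); first exact: to_quotientM.
  transitivity (to_quotient c * to_quotient a); last exact/esym/to_quotientM.
  by rewrite -ea e_central.
- by left; rewrite ea act_eq0_to_quotient.
right; apply/eqP; rewrite -subr_eq0 ea -(quot_pi1 (ideal_gen relator)).
rewrite -(quot_pi1 (Ann M)) -[quot_pi _ (quot_pi _ 1)]/(to_quotient 1).
rewrite -to_quotientB.
apply/eqP/act_eq0_to_quotient => x Wx.
by rewrite actB Defs.act1 a1 // subrr.
Qed.

End PieceQuotient.

Theorem corollary30 (R : realType)
  (P : set prime_nat)
  (P_nonempty : exists p, P p)
  (P_odd : forall p, P p -> odd (val p))
  (M : submodule R[i] P)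
  (M_nonzero : exists2 x, M x & x != 0)
  (M_span : spanned_by_odd_simples M)
  (M_full : all_or_none M)
  (p : set_type P) :
  indecomposable
    (alg_quot (ideal_gen
       (quot_res M p * quot_ind M p - (val (val p))%:R : quotA M))) /\
  indecomposable
    (alg_quot (ideal_gen (quot_res M p * quot_ind M p - 1 : quotA M))).
Proof.
have M_odd x : M x -> forall k, k \in msupp x -> odd (val (tag k)).
  by move=> Mx; apply: lspan_odd M_span Mx.
split; first exact: (@piece_quotient_indecomposable _ _ P_odd M M_odd p true).
exact: (@piece_quotient_indecomposable _ _ P_odd M M_odd p false).
Qed.
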